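(* Let $f(\hat{x}) = s(\hat{x}) + z(\hat{x})$ on the unit sphere $\mathbb{S}^2$, where $s$ and $z$ are realizations of zero-mean Gaussian (possibly anisotropic) random processes on $\mathbb{S}^2$ that are uncorrelated, $\mathbb{E}\{\hat{s}_c\overline{\hat{z}_{c'}}\}=0$ for all $c,c'$, with spectral covariance matrices $\mathbf{C}_S^{cc'} = \mathbb{E}\{\hat{s}_c\overline{\hat{s}_{c'}}\}$ and $\mathbf{C}_Z^{cc'} = \mathbb{E}\{\hat{z}_c\overline{\hat{z}_{c'}}\}$. Let $h$ be an azimuthally symmetric window on $\mathbb{S}^2$, band-limited with maximum degree $L_h$ and with $\langle h,h\rangle = 1$, and put $N_h = L_h^2+2L_h$. For a filter function $\boldsymbol{\zeta}(\hat{y}) = (\zeta(\hat{y};0),\zeta(\hat{y};1),\dots)$ with components $\zeta(\hat{y};n) = \sum_{r=0}^{N_h} \hat{\zeta}_n^{r}\, Y_r(\hat{y})$, define the filtered distribution $v(\hat{y};n) = \big(g_f(\cdot\,;n)\circledast \zeta(\cdot\,;n)\big)(\hat{y})$ and the spatio-spectral mean-square error $$\mathcal{E}_{ss} = \mathbb{E}\Big\{\sum_{n=0}^{\infty} \big\| v(\cdot\,;n) - g_s(\cdot\,;n)\big\|^2\Big\}.$$ Define, for $(p,q)\leftrightarrow r$, $$H(c;r;n) = (-1)^q\sqrt{\tfrac{4\pi}{2p+1}}\,\hat{h}_p^{0}\, T(c;\,p,-q;\,n),$$ where $T(c;p,-q;n)$ denotes $T(c;r';n)$ with $(p,-q)\leftrightarrow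 r'$. Then the spectral response of the filter minimizing $\mathcal{E}_{ss}$ (over the coefficients $\hat{\zeta}_n^{r}$, $n\ge 0$, $0\le r\le N_h$) is given by $$\hat{\zeta}_n^{r} = \frac{\sum_{c=0}^{\infty}\sum_{c'=0}^{\infty} H(c;r;n)H(c';r;n)\,\mathbf{C}_S^{cc'}}{\sum_{c=0}^{\infty}\sum_{c'=0}^{\infty} H(c;r;n)H(c';r;n)\,\big(\mathbf{C}_S^{cc'}+\mathbf{C}_Z^{cc'}\big)}$$ for those $n,r$ for which the denominator $\sum_{c,c'} H(c;r;n)H(c';r;n)(\mathbf{C}_S^{cc'}+\mathbf{C}_Z^{cc'})$ is $>0$, and $\hat{\zeta}_n^{r}=0$ otherwise.
   Context: Points of $\mathbb{S}^2$ are $\hat{x}=(\sin\theta\cos\phi,\sin\theta\sin\phi,\cos\theta)$, $\theta\in[0,\pi]$, $\phi\in[0,2\pi)$; inner product $\langle f,g\rangle=\int_{\mathbb{S}^2} f\,\overline{g}\,\sin\theta\,d\theta\,d\phi$, norm $\|f\|=\langle f,f\rangle^{1/2}$. Spherical harmonics $Y_\ell^m(\theta,\phi)=N_\ell^m P_\ell^m(\cos\theta)e^{im\phi}$ with $N_\ell^m=\sqrt{\frac{2\ell+1}{4\pi}\frac{(\ell-m)!}{(\ell+m)!}}$ and $P_\ell^m$ the associated Legendre functions including the Condon–Shortley phase $(-1)^m$; they form an orthonormal basis of $L^2(\mathbb{S}^2)$. Pairs $(\ell,m)$, $|m|\le\ell$, are indexed by a single integer via $(\ell,m)\leftrightarrow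 n$, $n=\ell^2+\ell+m$; write $Y_n=Y_\ell^m$ and $\hat{f}_n=\hat{f}_\ell^m=\langle f,Y_\ell^m\rangle$. A function is band-limited with maximum degree $L$ if $\hat f_\ell^m=0$ for $\ell>L$; it is azimuthally symmetric if it depends only on $\theta$. Triple product: $T(c;r;n)=\int_{\mathbb{S}^2} Y_r(\hat x)Y_c(\hat x)\overline{Y_n(\hat x)}\,ds(\hat x)$. Rotation of an azimuthally symmetric $h$ to $\hat y=\hat y(\vartheta,\varphi)$: $\mathcal{D}(\hat y)h$ is the function with coefficients $(\mathcal{D}(\hat y)h)_\ell^m=\sqrt{\frac{4\pi}{2\ell+1}}\,\overline{Y_\ell^m(\vartheta,\varphi)}\,\hat h_\ell^0$. Spatially localized spherical harmonic transform (SLSHT) distribution of a signal $f$: $g_f(\hat y;n)=\int_{\mathbb{S}^2}(\mathcal{D}(\hat y)h)(\hat x)\,f(\hat x)\,\overline{Y_n(\hat x)}\,ds(\hat x)$, viewed as a function of $\hat y$ for each $n\ge 0$ (similarly $g_s$ for $s$). Convolution: $(h\circledast f)(\hat y)=\sum_{\ell\ge0}\sum_{m=-\ell}^{\ell}\hat h_\ell^m\hat f_\ell^m Y_\ell^m(\hat y)$. The expectation $\mathbb{E}$ is over the signal and noise processes.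
   Formalization: The window h is additionally assumed real-valued; for complex windows such as h = i·Y_0 the denominator is negative, so the rule ''0 otherwise'' would not give the minimizing filter. *)

(* Defs.v *)
From HB Require Import structures.
From mathcomp Require Import all_boot all_order all_algebra.
From mathcomp Require Import all_classical all_reals all_analysis.
From mathcomp Require Import complex.
Set Implicit Arguments.
Unset Strict Implicit.
Unset Printing Implicit Defensive.
Import Order.TTheory GRing.Theory Num.Theory.
Local Open Scope classical_set_scope.
Local Open Scope ring_scope.

Section SphereDefs.
Variable R : realType.
Local Notation C := R[i].

(** Parameter domain of the sphere: theta in [0,pi], phi in [0,2pi). *)
Definition S2dom : set (R * R) := `[0, pi]%classic `*` `[0, 2 * pi[%classic.

(** Lebesgue measure on R x R; the surface element is sin(theta) dtheta dphi. *)
Definition leb2 := ((@lebesgue_measure R) \x (@lebesgue_measure R))%E.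

Definition sint (F : R * R -> R) : R :=
  Rintegral leb2 S2dom (fun x => F x * sin x.1).

Definition cint (F : R * R -> C) : C :=
  Complex (sint (fun x => complex.Re (F x))) (sint (fun x => complex.Im (F x))).

Definition sinner (f g : R * R -> C) : C := cint (fun x => f x * (g x)^* ).

Definition sqnorm (F : R * R -> C) : \bar R :=
  (\int[leb2]_(x in S2dom)
     ((complex.Re (F x) ^+ 2 + complex.Im (F x) ^+ 2) * sin x.1)%:E)%E.

(** Associated Legendre functions (Rodrigues' formula, with the
    Condon-Shortley phase (-1)^m), first for m >= 0 ... *)
Definition legendre_dpoly (l m : nat) : {poly R} :=
  (('X ^+ 2 - 1) ^+ l)^`(l + m).

Definition assoc_legendre_nat (l m : nat) (x : R) : R :=
  (-1) ^+ m * (Num.sqrt (1 - x ^+ 2)) ^+ m * (legendre_dpoly l m).[x]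
    / (2%:R ^+ l * (l`!)%:R).

Definition assoc_legendre (l : nat) (m : int) (x : R) : R :=
  match m with
  | Posz k => assoc_legendre_nat l k x
  | Negz k => (-1) ^+ k.+1 * (((l - k.+1)`!)%:R / ((l + k.+1)`!)%:R)
                * assoc_legendre_nat l k.+1 x
  end.

Definition sh_norm (l : nat) (m : int) : R :=
  Num.sqrt ((2 * l%:R + 1) / (4 * pi)
            * (((absz (l%:Z - m))`!)%:R / ((absz (l%:Z + m))`!)%:R)).

Definition Ylm (l : nat) (m : int) (x : R * R) : C :=
  (sh_norm l m * assoc_legendre l m (cos x.1))%:C%C
  * Complex (cos (m%:~R * x.2)) (sin (m%:~R * x.2)).

(** Single index n = l^2 + l + m. *)
Definition sh_deg (n : nat) : nat := \max_(l < n.+1 | (l * l <= n)%N) (l : nat).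
Definition sh_ord (n : nat) : int := n%:Z - ((sh_deg n * sh_deg n + sh_deg n)%N)%:Z.
Definition sh_idx (l : nat) (m : int) : nat := absz (((l * l + l)%N)%:Z + m).

Definition Yn (n : nat) : R * R -> C := Ylm (sh_deg n) (sh_ord n).

Definition shcoef (f : R * R -> C) (n : nat) : C := sinner f (Yn n).

(** Rotation D(y) h of an azimuthally symmetric h band-limited to degree Lh:
    the function with coefficients sqrt(4pi/(2l+1)) conj(Y_l^m(y)) h^_l^0
    (all coefficients of degree > Lh vanish, so the expansion is finite). *)
Definition rot (Lh : nat) (h : R * R -> C) (y : R * R) (x : R * R) : C :=
  \sum_(n < (Lh.+1) ^ 2)
     ((Num.sqrt (4 * pi / (2 * (sh_deg n)%:R + 1)))%:C%C * (Yn n y)^*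
       * shcoef h (sh_deg n * sh_deg n + sh_deg n) * Yn n x).

Definition slsht (Lh : nat) (h : R * R -> C) (f : R * R -> C) (y : R * R) (n : nat) : C :=
  cint (fun x => rot Lh h y x * f x * (Yn n x)^* ).

(** Convolution conv(g,k)(y) = sum_n g^_n k^_n Y_n(y), for k band-limited
    to degree L (terms of degree > L vanish). *)
Definition conv_bl (L : nat) (g k : R * R -> C) (y : R * R) : C :=
  \sum_(r < (L.+1) ^ 2) (shcoef g r * shcoef k r * Yn r y).

(** Filter component zeta(y; n) = sum_{r=0}^{N_h} zh n r Y_r(y),
    N_h = Lh^2 + 2 Lh, i.e. r < (Lh+1)^2. *)
Definition zeta_fun (Lh : nat) (zh : nat -> nat -> C) (n : nat) (y : R * R) : C :=
  \sum_(r < (Lh.+1) ^ 2) (zh n r * Yn r y).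

Definition triple (c r n : nat) : C := cint (fun x => Yn r x * Yn c x * (Yn n x)^* ).

Definition Hcoef (h : R * R -> C) (c r n : nat) : C :=
  let p := sh_deg r in let q := sh_ord r in
  (-1) ^+ (absz q) * (Num.sqrt (4 * pi / (2 * p%:R + 1)))%:C%C
    * shcoef h (p * p + p) * triple c (sh_idx p (- q)) n.

Definition cseries (a : nat -> C) : C :=
  Complex (limn (fun N => \sum_(k < N) complex.Re (a k)))
          (limn (fun N => \sum_(k < N) complex.Im (a k))).

Definition dseries (a : nat -> nat -> C) : C :=
  cseries (fun c => cseries (fun c' => a c c')).

Section Prob.
Context {d : measure_display} {T : measurableType d} (P : probability T R).

Definition cexpect (X : T -> C) : C :=
  Complex (fine (\int[P]_w (complex.Re (X w))%:E)%E)
          (fine (\int[P]_w (complex.Im (X w))%:E)%E).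

(** Centered (possibly degenerate) real Gaussian random variable,
    via its characteristic function E[exp(itX)] = exp(-v t^2/2). *)
Definition centered_gaussian (X : T -> R) : Prop :=
  exists2 v : R, 0 <= v & forall t : R,
    (\int[P]_w (cos (t * X w))%:E)%E = (expR (- (v * t ^+ 2) / 2))%:E /\
    (\int[P]_w (sin (t * X w))%:E)%E = 0%E.

Definition centered_gaussian_process (s : T -> R * R -> C) : Prop :=
  forall (k : nat) (x : 'I_k -> R * R) (a b : 'I_k -> R),
    (forall i, S2dom (x i)) ->
    centered_gaussian (fun w => \sum_(i < k)
       (a i * complex.Re (s w (x i)) + b i * complex.Im (s w (x i)))).

Definition measurable_process (s : T -> R * R -> C) : Prop :=
  measurable_fun setT (fun wx : T * (R * R) => complex.Re (s wx.1 wx.2)) /\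
  measurable_fun setT (fun wx : T * (R * R) => complex.Im (s wx.1 wx.2)).

Definition spec_cov (s z : T -> R * R -> C) (c c' : nat) : C :=
  cexpect (fun w => shcoef (s w) c * (shcoef (z w) c')^* ).

Definition Ess (Lh : nat) (h : R * R -> C) (s z : T -> R * R -> C)
    (zh : nat -> nat -> C) : \bar R :=
  (\int[P]_w \sum_(n <oo)
     sqnorm (fun y =>
       (conv_bl Lh (fun y' => slsht Lh h (fun x => s w x + z w x) y' n)
                   (zeta_fun Lh zh n) y
        - slsht Lh h (s w) y n)%R))%E.

Definition zeta_opt (h : R * R -> C) (s z : T -> R * R -> C) (n r : nat) : C :=
  let num := dseries (fun c c' => Hcoef h c r n * Hcoef h c' r n * spec_cov s s c c') in
  let den := dseries (fun c c' => Hcoef h c r n * Hcoef h c' r n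
                                   * (spec_cov s s c c' + spec_cov z z c c')) in
  if 0 < den then num / den else 0.

End Prob.
End SphereDefs.

(* Main.v *)
(** Put G_r(f) = sum_c H(c;r;n) f^_c.  The distribution g_f(y;n) is the finite sum
    over r < (Lh+1)^2 of G_r(f) Y_r(y), so by Parseval's identity and Tonelli's theorem
    E_ss is the sum over n and r of E|zeta G_r(s+z) - G_r(s)|^2.  As s and z are
    uncorrelated, each summand equals |zeta-1|^2 E|G_r(s)|^2 + |zeta|^2 E|G_r(z)|^2,
    which is minimal exactly at zeta = E|G_r(s)|^2 / (E|G_r(s)|^2 + E|G_r(z)|^2) when this
    denominator is positive and is identically zero otherwise.  The sum over c is
    finite, and H is real, because Y_n conj(Y_r) is a real linear combination of
    finitely many spherical harmonics. *)
Require Import Defs.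
From HB Require Import structures.
From mathcomp Require Import all_boot all_order all_algebra.
From mathcomp Require Import all_classical all_reals all_analysis.
From mathcomp Require Import complex measurable_realfun.
From mathcomp Require Import ring lra zify.
Import Order.TTheory GRing.Theory Num.Theory.
Import numFieldNormedType.Exports.
Local Open Scope classical_set_scope.
Local Open Scope ring_scope.
Set Implicit Arguments.
Unset Strict Implicit.

(** * Legendre polynomials: orthogonality by Rodrigues' formula *)

Section PolyIntegral.
Variable F : realFieldType.
Implicit Types p q : {poly F}.

(** The obstacle is that the formula for the filter contains iterated infinite series, which would
    have to be exchanged with the expectation. It disappears once each [H] has finite support in
    [c]. That support, the reality of [H] and Parseval's identity all rest on one family of
    polynomials: for fixed [k], [legD l k] has degree exactly [l - k], and these polynomials are
    orthogonal on [-1, 1] for the weight (1 - x^2)^k. The degrees give the finite real expansion of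
    products of harmonics, the orthogonality gives orthonormality. To keep Rodrigues' argument
    purely algebraic, the integral over [-1, 1] is a formal functional [pint] on polynomials; it
    meets the Lebesgue integral only through the substitution x = cos t in [Rintegral_poly_cos]. *)

Definition pprim p : {poly F} := \poly_(i < (size p).+1) (p`_i.-1 / i%:R *+ (i != 0%N)).

Lemma deriv_pprim p : (pprim p)^`() = p.
Proof.
apply/polyP => i; rewrite coef_deriv coef_poly ltnS /=.
case: ltnP => hi; last by rewrite mul0rn nth_default.
by rewrite mulr1n -[LHS]mulr_natr divfK // pnatr_eq0.
Qed.

(* The integral of [p] over [-1, 1]. *)
Definition pint p : F := (pprim p).[1] - (pprim p).[-1].

Lemma deriv0_const p : p^`() = 0 -> p = (p`_0)%:P.
Proof.
move=> p0; apply/polyP => -[|i]; rewrite coefC //=.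
have := congr1 (fun q : {poly F} => q`_i) p0; rewrite coef_deriv coef0 => /eqP.
by rewrite mulrn_eq0 /= => /eqP.
Qed.

(** Two antiderivatives differ by a constant, which cancels between the endpoints, so any
    antiderivative computes [pint]. Linearity and integration by parts follow from this alone. *)
Lemma pint_deriv p : pint p^`() = p.[1] - p.[-1].
Proof.
have /deriv0_const : (pprim p^`() - p)^`() = 0 by rewrite derivB deriv_pprim subrr.
by rewrite /pint; set c := _`_0; move/(canRL (subrK p)) => ->; rewrite !hornerD !hornerC; ring.
Qed.

Lemma pintD p q : pint (p + q) = pint p + pint q.
Proof.
have := pint_deriv (pprim p + pprim q).
by rewrite derivD !deriv_pprim => ->; rewrite /pint !hornerD; ring.
Qed.

Lemma pintZ a p : pint (a *: p) = a * pint p.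
Proof.
have := pint_deriv (a *: pprim p).
by rewrite derivZ !deriv_pprim => ->; rewrite /pint !hornerZ; ring.
Qed.

Lemma pint0 : pint 0 = 0.
Proof. by rewrite -(scale0r 0) pintZ mul0r. Qed.

Lemma pint_parts p q : p.[1] * q.[1] = 0 -> p.[-1] * q.[-1] = 0 ->
  pint (p * q^`()) = - pint (p^`() * q).
Proof.
move=> h1 h2; have := pint_deriv (p * q).
by rewrite derivM pintD !hornerM h1 h2 subrr addrC => /eqP; rewrite addr_eq0 => /eqP.
Qed.

Local Notation u := ('X^2 - 1 : {poly F}).

Lemma u_pm1 (e : F) : e ^+ 2 = 1 -> u.[e] = 0.
Proof. by move=> h; rewrite !hornerE h subrr. Qed.

(** Each differentiation costs only one factor [u]; the cofactor is left unspecified because only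
    the order of vanishing at +-1 matters. *)
Lemma deriv_uM l q : exists q', (u ^+ l.+1 * q)^`() = u ^+ l * q'.
Proof.
exists ((l.+1%:R * u^`()) * q + u * q^`()).
rewrite derivM deriv_exp /=; move: (u^`()) (u) (q^`()) => a b c.
by rewrite -[X in X * q]mulr_natl exprS; ring.
Qed.

Lemma derivn_u_vanish l (q : {poly F}) (e : F) : e ^+ 2 = 1 ->
  forall i, (i < l)%N -> (u ^+ l * q)^`(i).[e] = 0.
Proof.
move=> he i; elim: i l q => [|i IH] [|l] q // il.
  by rewrite derivn0 exprS !hornerM u_pm1 // !mul0r.
by rewrite derivSn; have [q' ->] := deriv_uM l q; apply: IH.
Qed.

(** The pairs with [(i + j).+1 = n] index the boundary terms of [n] successive integrations by
    parts. Asking only that each product vanish lets either factor be responsible. *)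
Lemma pint_partsn n p q :
  (forall i j (e : F), (i + j).+1 = n -> e ^+ 2 = 1 ->
      p^`(i).[e] * q^`(j).[e] = 0) ->
  pint (p * q^`(n)) = (-1) ^+ n * pint (p^`(n) * q).
Proof.
elim: n p => [|n IH] p H; first by rewrite expr0 mul1r.
have H0 e : e ^+ 2 = 1 -> p.[e] * q^`(n).[e] = 0 by move=> e2; exact: (H 0%N n e).
rewrite derivnS pint_parts ?H0 ?sqrrN ?expr1n //.
rewrite IH; first by rewrite exprS -derivSn; ring.
by move=> i j e eij e2; rewrite -derivSn H ?addSn ?eij.
Qed.

(* [2 ^ l * l!] times the [k]-th derivative of the [l]-th Legendre polynomial. *)
Definition legD l k : {poly F} := (u ^+ l)^`(l + k).

Lemma size_u : size u = 3.
Proof. by rewrite size_addl ?size_polyXn // size_opp size_poly1. Qed.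

Lemma u_monic : u \is monic.
Proof. by rewrite monicE lead_coefDl ?lead_coefXn // size_polyXn size_polyN size_poly1. Qed.

Lemma size_uX l : size (u ^+ l) = (2 * l).+1.
Proof.
by rewrite -[LHS]prednK ?size_exp ?size_u // lt0n size_poly_eq0 monic_neq0 // monic_exp // u_monic.
Qed.

Lemma coef_uX l : (u ^+ l)`_(2 * l) = 1.
Proof. by have /monicP := monic_exp l u_monic; rewrite /lead_coef size_uX. Qed.

Lemma size_legD l k : (k <= l)%N -> size (legD l k) = (l - k).+1.
Proof.
move=> kl; apply/eqP; rewrite eqn_leq; apply/andP; split.
  apply/leq_sizeP => j hj; rewrite coef_derivn nth_default ?mul0rn // size_uX; lia.
rewrite ltnNge; apply/negP => /leq_sizeP/(_ _ (leqnn _)).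
rewrite coef_derivn (_ : (l + k + (l - k) = 2 * l)%N); last lia.
by rewrite coef_uX => /eqP; rewrite pnatr_eq0 -leqn0 leqNgt ffact_gt0; lia.
Qed.

Lemma coef_legD l k : (k <= l)%N -> (legD l k)`_(l - k) = ((2 * l) ^_ (l + k))%:R.
Proof.
move=> kl; rewrite coef_derivn (_ : (l + k + (l - k) = 2 * l)%N); last lia.
by rewrite coef_uX.
Qed.

Lemma size_uD l k : (k <= l)%N -> size (u ^+ k * legD l k) = (l + k).+1.
Proof.
move=> kl; rewrite size_monicM ?monic_exp ?u_monic //; last first.
  by rewrite -size_poly_eq0 size_legD.
by rewrite size_uX size_legD //; lia.
Qed.

Lemma coef_uD l k : (k <= l)%N ->
  (u ^+ k * legD l k)`_(l + k) = ((2 * l) ^_ (l + k))%:R.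
Proof.
move=> kl; rewrite -coef_legD //.
have := lead_coef_monicM (legD l k) (monic_exp k u_monic).
by rewrite /lead_coef size_uD // size_legD.
Qed.

(* All boundary terms vanish at +-1: the first [k] derivatives of the left factor are
   divisible by [u], and so are the first [l'] derivatives of [u ^+ l']. *)
Lemma legD_parts l l' k : (k <= l)%N -> (k <= l')%N ->
  pint (u ^+ k * legD l k * legD l' k) =
  (-1) ^+ (l' + k) * pint ((u ^+ k * legD l k)^`(l' + k) * u ^+ l').
Proof.
move=> kl kl'; rewrite {2}/legD pint_partsn // => i j e ij e2.
case: (ltnP i k) => ik; first by rewrite derivn_u_vanish // mul0r.
by rewrite -[u ^+ l']mulr1 [X in _ * X]derivn_u_vanish ?mulr0 //; lia.
Qed.

(** The left factor [u ^+ k * legD l k] has degree [l + k], so moving all [l' + k] derivatives onto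
    it kills it. *)
Lemma legD_ortho_lt l l' k : (k <= l)%N -> (l < l')%N ->
  pint (u ^+ k * legD l k * legD l' k) = 0.
Proof.
move=> kl ll'; rewrite legD_parts //; last lia.
rewrite (_ : _^`(_) = 0) ?mul0r ?pint0 ?mulr0 //.
by apply/polyP => i; rewrite coef_derivn coef0 nth_default ?mul0rn // size_uD //; lia.
Qed.

Lemma legD_ortho l l' k : (k <= l)%N -> (k <= l')%N -> l != l' ->
  pint (u ^+ k * legD l k * legD l' k) = 0.
Proof.
move=> kl kl'; rewrite neq_ltn => /orP[] ll'; first exact: legD_ortho_lt.
by rewrite mulrAC legD_ortho_lt.
Qed.

(** Integrate [u ^+ l.+1] against the derivative of ['X] by parts; since X^2 = u + 1, the new
    integrand is again a combination of [u ^+ l.+1] and [u ^+ l]. *)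
Lemma pint_uXS l : pint (u ^+ l.+1) * (2 * l%:R + 3) = - (2 * l.+1%:R) * pint (u ^+ l).
Proof.
have h : pint (u ^+ l.+1 * ('X)^`()) = - pint ((u ^+ l.+1)^`() * 'X).
  by apply: pint_parts; rewrite exprS !hornerM u_pm1 ?mul0r // ?sqrrN ?expr1n.
move: h; rewrite derivX mulr1.
have -> : (u ^+ l.+1)^`() * 'X = (2 * l.+1%:R) *: (u ^+ l.+1 + u ^+ l).
  rewrite deriv_exp /=.
  have -> : u^`() = 2 * 'X by rewrite derivB derivXn derivC subr0 /= mulr2n; ring.
  rewrite -[X in X * 'X]mulr_natl -mul_polyC.
  have -> : (2 * l.+1%:R)%:P = 2 * l.+1%:R :> {poly F} by rewrite polyCM !polyC_natr.
  move: (l.+1%:R : {poly F}) => c; rewrite [u ^+ l.+1]exprS; ring.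
rewrite pintZ pintD => h; rewrite -natr1 in h *; lra.
Qed.

Lemma pint_uX l : pint (u ^+ l) =
  (-1) ^+ l * 2 ^+ (2 * l).+1 * (l`!)%:R ^+ 2 / ((2 * l).+1`!)%:R.
Proof.
elim: l => [|l IH].
  rewrite !expr0 -derivX pint_deriv !hornerX /= mul1r fact0 expr1n mulr1 divr1 expr1 opprK //.
have f0 n : (n`!)%:R != 0 :> F by rewrite pnatr_eq0 -lt0n fact_gt0.
have n0 : 2 * l%:R + 3 != 0 :> F by rewrite -natrM -natrD pnatr_eq0 addn3.
apply: (mulIf n0); rewrite pint_uXS IH.
have -> : ((2 * l.+1).+1`! = (2 * l).+3 * ((2 * l).+2 * (2 * l).+1`!))%N.
  by rewrite -!factS; congr (_`!); lia.
have -> : 2 ^+ (2 * l.+1).+1 = 4 * 2 ^+ (2 * l).+1 :> F.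
  by rewrite (_ : (2 * l.+1).+1 = (2 * l).+3)%N ?(exprS _ (2 * l).+2) ?(exprS _ (2 * l).+1); [ring|lia].
rewrite (factS l) (natrM _ (2 * l).+3) (natrM _ (2 * l).+2) (natrM _ l.+1) (exprS _ l).
have e1 : (2 * l).+3%:R = 2 * l%:R + 3 :> F by rewrite -natrM -natrD addn3.
have e2 : (2 * l).+2%:R = 2 * l.+1%:R :> F by rewrite -natrM; congr _%:R; lia.
have l0 : l.+1%:R != 0 :> F by rewrite pnatr_eq0.
rewrite e1 e2; move: (f0 (2 * l).+1) (f0 l) l0 n0.
move: ((2 * l).+1`!%:R : F) (l`!%:R : F) (l.+1%:R : F) => a b c a0 b0 c0 n0.
by field; rewrite a0 c0 n0.
Qed.

(** Differentiating a polynomial of degree [l + k] exactly [l + k] times leaves its leading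
    coefficient times a factorial, so only the Beta integral [pint_uX] remains. The sign [(-1) ^+ k]
    makes the weight (1 - x^2)^k, since [u] is x^2 - 1. *)
Lemma legD_norm l k : (k <= l)%N ->
  (-1) ^+ k * pint (u ^+ k * legD l k * legD l k) =
  2 ^+ (2 * l).+1 * (l`!)%:R ^+ 2 / (2 * l).+1%:R * (l + k)`!%:R / (l - k)`!%:R.
Proof.
move=> kl; rewrite legD_parts //.
have -> : (u ^+ k * legD l k)^`(l + k) =
    (((2 * l) ^_ (l + k) * (l + k)`!)%:R : F)%:P.
  apply/polyP => i; rewrite coef_derivn coefC; case: i => [|i] /=.
    by rewrite addn0 coef_uD // ffactnn mulrnA.
  by rewrite nth_default ?mul0rn // size_uD //; lia.
rewrite mul_polyC pintZ pint_uX !mulrA -exprD.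
have f0 n : (n`!)%:R != 0 :> F by rewrite pnatr_eq0 -lt0n fact_gt0.
have n0 : (2 * l).+1%:R != 0 :> F by rewrite pnatr_eq0.
have e : ((2 * l) ^_ (l + k) * (l - k)`!)%N = (2 * l)`!.
  rewrite -(ffact_fact (_ : l + k <= 2 * l)%N); last lia.
  by congr (_ * _`!)%N; lia.
rewrite factS (natrM _ (2 * l).+1) -e (natrM _ _ (l - k)`!) (natrM _ _ (l + k)`!).
have g0 : ((2 * l) ^_ (l + k))%:R != 0 :> F.
  by rewrite pnatr_eq0 -lt0n ffact_gt0; lia.
(* One sign comes from the weight, one from the integrations by parts and one from [pint_uX]; the
   total exponent is even. *)
have s : (-1) ^+ (k + (l + k)) * (-1) ^+ l = 1 :> F.
  by rewrite -exprD -signr_odd (_ : odd _ = false) //; lia.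
transitivity ((-1) ^+ (k + (l + k)) * (-1) ^+ l * (2 ^+ (2 * l).+1 * (l`!)%:R ^+ 2
   / (2 * l).+1%:R * (l + k)`!%:R / (l - k)`!%:R) : F); last first.
  by rewrite s mul1r expr2 !mulrA.
move: (f0 l) (f0 (l - k)%N) (f0 (l + k)%N) n0 g0.
move: (2 * l).+1%:R (l`!%:R : F) ((l - k)`!%:R : F) ((l + k)`!%:R : F) => N a b c.
by move: ((2 * l) ^_ (l + k))%:R => g a0 b0 c0 n0 g0; field; rewrite n0 b0 g0.
Qed.

End PolyIntegral.

(** * Spherical harmonics: indexing, conjugation and products *)

Section Index.

(** [sh_deg] is the integer square root: degree l occupies the indices from l^2 to (l+1)^2 - 1.
    These bounds determine it and make index arithmetic accessible to [nia]. *)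
Lemma sh_deg_bounds n : (sh_deg n * sh_deg n <= n < (sh_deg n).+1 * (sh_deg n).+1)%N.
Proof.
rewrite /sh_deg; apply/andP; split.
  by elim/big_ind : _ => // x y hx hy; rewrite /maxn; case: ifP.
rewrite ltnNge; apply/negP => h.
have l_lt : ((\max_(l < n.+1 | (l * l <= n)%N) (l : nat)).+1 < n.+1)%N.
  by rewrite ltnS; apply: leq_trans h; rewrite leq_pmull.
have := @leq_bigmax_cond _ (fun l : 'I_n.+1 => l * l <= n)%N (fun l => l : nat) (Ordinal l_lt) h.
by rewrite /= ltnn.
Qed.

Lemma sh_deg_eq n l : (l * l <= n < l.+1 * l.+1)%N -> sh_deg n = l.
Proof. by have := sh_deg_bounds n; nia. Qed.

Lemma sh_ord_le n : (`|sh_ord n| <= sh_deg n)%N.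
Proof. by have := sh_deg_bounds n; rewrite /sh_ord; nia. Qed.

Lemma sh_idxE n l m : (`|m| <= l)%N -> n = sh_idx l m -> (sh_deg n = l) * (sh_ord n = m).
Proof.
move=> ml nE; have dE : sh_deg n = l by apply: sh_deg_eq; rewrite nE /sh_idx; nia.
by split=> //; rewrite /sh_ord dE nE /sh_idx; nia.
Qed.

Lemma sh_deg_idx l m : (`|m| <= l)%N -> sh_deg (sh_idx l m) = l.
Proof. by move=> ml; rewrite (sh_idxE ml erefl). Qed.

Lemma sh_ord_idx l m : (`|m| <= l)%N -> sh_ord (sh_idx l m) = m.
Proof. by move=> ml; rewrite (sh_idxE ml erefl). Qed.

Lemma sh_idxK n : sh_idx (sh_deg n) (sh_ord n) = n.
Proof. by have := sh_deg_bounds n; rewrite /sh_idx /sh_ord; nia. Qed.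

Lemma sh_deg_leE n L : (n < L.+1 ^ 2)%N = (sh_deg n <= L)%N.
Proof. by have := sh_deg_bounds n; rewrite expnS expn1; nia. Qed.

Definition sh_neg n := sh_idx (sh_deg n) (- sh_ord n).

Lemma sh_deg_neg n : sh_deg (sh_neg n) = sh_deg n.
Proof. by rewrite sh_deg_idx // abszN sh_ord_le. Qed.

Lemma sh_ord_neg n : sh_ord (sh_neg n) = - sh_ord n.
Proof. by rewrite sh_ord_idx // abszN sh_ord_le. Qed.

Lemma sh_negK : involutive sh_neg.
Proof. by move=> n; rewrite {1}/sh_neg sh_deg_neg sh_ord_neg opprK sh_idxK. Qed.

End Index.

Section Harmonics.
Variable R : realType.
Local Notation C := R[i].
Implicit Types (l k : nat) (m : int) (x : R * R) (t : R).

Definition cis t : C := Complex (cos t) (sin t).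

Lemma cisD t t' : cis (t + t') = cis t * cis t'.
Proof. by apply/eqP; rewrite eq_complex /= cosD sinD addrC [X in _ && (_ == X)]addrC !eqxx. Qed.

Lemma cisN t : cis (- t) = (cis t)^*.
Proof. by apply/eqP; rewrite eq_complex /= cosN sinN !eqxx. Qed.

Lemma conjC_real t : (t%:C%C)^* = t%:C%C :> C.
Proof. by apply/eqP; rewrite eq_complex /= oppr0 !eqxx. Qed.

Lemma conjC_mul (a b : C) : (a * b)^* = a^* * b^*.
Proof. exact: rmorphM. Qed.

Lemma rcM (a b : R) : (a * b)%:C%C = a%:C%C * b%:C%C :> C.
Proof. exact: rmorphM. Qed.

Lemma rcD (a b : R) : (a + b)%:C%C = a%:C%C + b%:C%C :> C.
Proof. exact: rmorphD. Qed.

Lemma rc_sign n : ((-1) ^+ n)%:C%C = (-1) ^+ n :> C.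
Proof. by rewrite rmorphXn rmorphN1. Qed.

(** The factorial ratio produced here cancels the inverse ratio in the definition of
    [assoc_legendre] for negative orders. *)
Lemma sh_normE l k : (k <= l)%N -> sh_norm R l (- k%:Z) = sh_norm R l k * ((l + k)`!%:R / (l - k)`!%:R).
Proof.
move=> kl; rewrite /sh_norm opprK.
have -> : `|(l%:Z - k%:Z)%R|%N = (l - k)%N by lia.
have -> : `|(l%:Z + k%:Z)%R|%N = (l + k)%N by lia.
have f0 n : 0 < (n`!)%:R :> R by rewrite ltr0n fact_gt0.
set b : R := (l + k)`!%:R / _.
have b0 : 0 < b by rewrite divr_gt0.
rewrite -[in RHS](ger0_norm (ltW b0)) -sqrtr_sqr -sqrtrM; last first.
  rewrite mulr_ge0 ?divr_ge0 ?mulr_ge0 ?pi_ge0 // addr_ge0 // mulr_ge0 //.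
have [/lt0r_neq0 u0 /lt0r_neq0 v0 /lt0r_neq0 p0] := And3 (f0 (l - k)%N) (f0 (l + k)%N) (pi_gt0 R).
congr Num.sqrt; rewrite /b; move: (pi : R) p0 => p p0.
by field; rewrite u0 v0 p0.
Qed.

Definition ylm_amp l k : R := sh_norm R l k / (2 ^+ l * l`!%:R).

(** The Condon-Shortley sign survives for nonnegative orders only; for negative ones it meets a
    second copy of itself in [assoc_legendre]. *)
Definition ylm_cst l m : R :=
  (if m is Posz k then (-1) ^+ k else 1) * ylm_amp l `|m|.

Definition polar_sin x : R := Num.sqrt (1 - cos x.1 ^+ 2).

Lemma YlmE l m x : (`|m| <= l)%N -> Ylm l m x =
  (ylm_cst l m * polar_sin x ^+ `|m| * (legD R l `|m|).[cos x.1])%:C%C * cis (m%:~R * x.2).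
Proof.
move=> ml; congr ((_)%:C%C * _).
have lD k : legendre_dpoly R l k = legD R l k by [].
case: m ml => k ml.
  by rewrite /assoc_legendre /assoc_legendre_nat /ylm_cst /ylm_amp lD /polar_sin /=; ring.
rewrite NegzE sh_normE //= /assoc_legendre_nat /ylm_cst /ylm_amp lD /polar_sin /=.
have f0 n : (n`!)%:R != 0 :> R by rewrite pnatr_eq0 -lt0n fact_gt0.
have s : (-1) ^+ k.+1 * (-1) ^+ k.+1 = 1 :> R by rewrite -expr2 sqrr_sign.
set a := (-1) ^+ k.+1 in s *; set b := (l + k.+1)`!%:R; set c := (l - k.+1)`!%:R.
transitivity (a * a * (sh_norm R l k.+1 * (b / c * (c / b)) * Num.sqrt (1 - cos x.1 ^+ 2) ^+ k.+1 *
  (legD R l k.+1).[cos x.1] / (2 ^+ l * l`!%:R))); first by ring.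
by rewrite s mul1r mulrA divfK ?f0 // divff ?f0 //; ring.
Qed.

(** This is the normalization of the harmonics before any integration on the sphere: [2 * pi] stands
    for the integral over phi, the [pint] factor for the one over theta. *)
Lemma ylm_amp_sqr l k : (k <= l)%N ->
  ylm_amp l k ^+ 2 * (2 * pi) *
    ((-1) ^+ k * pint (('X^2 - 1) ^+ k * legD R l k * legD R l k)) = 1.
Proof.
move=> kl; rewrite legD_norm // /ylm_amp expr_div_n /sh_norm.
have -> : `|(l%:Z - k%:Z)%R|%N = (l - k)%N by lia.
have -> : `|(l%:Z + k%:Z)%R|%N = (l + k)%N by lia.
have f0 n : 0 < (n`!)%:R :> R by rewrite ltr0n fact_gt0.
have p0 := pi_gt0 R.
rewrite sqr_sqrtr; last first.
  by rewrite mulr_ge0 ?divr_ge0 ?mulr_ge0 ?pi_ge0 //; apply: addr_ge0.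
have -> : (2 * l).+1%:R = 2 * l%:R + 1 :> R by rewrite -natr1 natrM.
have -> : 2 ^+ (2 * l).+1 = 2 * (2 ^+ l) ^+ 2 :> R by rewrite exprS mulnC exprM.
have n0 : 2 * l%:R + 1 != 0 :> R by rewrite -natrM natr1 pnatr_eq0.
have t0 : 2 ^+ l != 0 :> R by rewrite expf_neq0.
move: (f0 l) (f0 (l - k)%N) (f0 (l + k)%N) p0 => /lt0r_neq0 a0 /lt0r_neq0 b0 /lt0r_neq0 c0 /lt0r_neq0.
move: (l`!%:R : R) ((l - k)`!%:R : R) ((l + k)`!%:R : R) (2 ^+ l : R) (pi : R) a0 b0 c0 t0
   => a b c d p a0 b0 c0 t0 p0.
by field; rewrite a0 b0 c0 t0 n0 p0.
Qed.

Lemma ylm_cst_neq0 l m : (`|m| <= l)%N -> ylm_cst l m != 0.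
Proof.
move=> ml; apply: mulf_neq0; first by case: m ml => k ?; rewrite ?signr_eq0 ?oner_eq0.
apply/eqP => a0; have := ylm_amp_sqr ml.
by rewrite a0 expr2 !mul0r => /eqP; rewrite eq_sym oner_eq0.
Qed.

Lemma ylm_cst_sqr l m : ylm_cst l m ^+ 2 = ylm_amp l `|m| ^+ 2.
Proof. by rewrite /ylm_cst; case: m => k; rewrite exprMn ?sqrr_sign ?expr1n mul1r. Qed.

Lemma ylm_cstN l m : ylm_cst l (- m) = (-1) ^+ `|m| * ylm_cst l m.
Proof.
rewrite /ylm_cst abszN; case: m => [[|k]|k] //=.
- by rewrite expr0 !mul1r.
- by rewrite mulrA -expr2 sqrr_sign.
- by rewrite mul1r.
Qed.

Lemma Yn_neg n x : Yn (sh_neg n) x = (-1) ^+ `|sh_ord n| * (Yn n x)^*.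
Proof.
rewrite /Yn sh_deg_neg sh_ord_neg !YlmE ?abszN ?sh_ord_le //.
rewrite ylm_cstN mulrNz mulNr cisN conjC_mul conjC_real -!mulrA [in LHS]rcM rc_sign.
by rewrite !mulrA.
Qed.

Lemma polar_sin_sqr x : polar_sin x ^+ 2 = 1 - cos x.1 ^+ 2.
Proof. by rewrite sqr_sqrtr // subr_ge0 expr_le1 // sqr_cos_le1. Qed.

(* The coefficients are required to be real: this is what makes H real. *)
Definition in_sh_span (f : R * R -> C) := exists s : seq (R * nat),
  forall x, f x = \sum_(p <- s) p.1%:C%C * Yn p.2 x.

(* For fixed [m], the degrees of the polynomials [legD l `|m|], [l >= `|m|], take every
   value once. *)
Lemma sector_in_sh_span m (Q : {poly R}) :
  in_sh_span (fun x => (polar_sin x ^+ `|m| * Q.[cos x.1])%:C%C * cis (m%:~R * x.2)).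
Proof.
have [n] := ubnP (size Q); elim: n Q => // n IH Q szQ.
have [->|Q0] := eqVneq Q 0.
  by exists [::] => x; rewrite big_nil horner0 mulr0 mul0r.
(* With this degree [legD R l] of order [|m|] has the same size as [Q], so subtracting the multiple
   [a] of it cancels the leading term. *)
pose l := (`|m| + (size Q).-1)%N.
have ml : (`|m| <= l)%N by rewrite leq_addr.
pose D := legD R l `|m|.
have sD : size D = size Q by rewrite size_legD // /l addKn prednK // lt0n size_poly_eq0.
have D0 : D != 0 by rewrite -size_poly_eq0 sD size_poly_eq0.
pose a := lead_coef Q / lead_coef D.
have szR : (size (Q - a *: D)%R < size Q)%N.
  rewrite -[X in (_ < X)%N]prednK ?lt0n ?size_poly_eq0 // ltnS; apply/leq_sizeP => j.
  rewrite leq_eqVlt coefB coefZ => /orP[/eqP <-|hj].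
    by rewrite -{2}sD -!lead_coefE /a divfK ?subrr // lead_coef_eq0.
  have Qj : (size Q <= j)%N by move: hj; case: (size Q).
  by rewrite !nth_default ?mulr0 ?subrr ?sD.
have [s hs] := IH _ (leq_trans szR szQ).
have c0 := ylm_cst_neq0 ml.
exists ((a / ylm_cst l m, sh_idx l m) :: s) => x.
rewrite big_cons -hs /Yn /= sh_deg_idx // sh_ord_idx // YlmE // mulrA -rcM -mulrDl -rcD.
congr (_%:C%C * _); rewrite -/D hornerD hornerN hornerZ.
by move: (ylm_cst l m) c0 => c c0; field.
Qed.

(** The product has azimuthal order [M = ma - mb] and carries the sine to the power |ma| + |mb|.
    This exceeds |M| by an even number [2 * j], and sin^2 = 1 - cos^2 turns the excess into a
    polynomial in the cosine, so [sector_in_sh_span] applies. *)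
Lemma mulJ_in_sh_span a b : in_sh_span (fun x => Yn a x * (Yn b x)^*).
Proof.
pose ma := sh_ord a; pose mb := sh_ord b; pose M := ma - mb.
pose j := ((`|ma| + `|mb| - `|M|) %/ 2)%N.
have jE : (`|ma| + `|mb| = `|M| + 2 * j)%N by rewrite /j /M; lia.
have [s hs] := sector_in_sh_span M
  ((ylm_cst (sh_deg a) ma * ylm_cst (sh_deg b) mb) *:
   ((1 - 'X^2) ^+ j * legD R (sh_deg a) `|ma| * legD R (sh_deg b) `|mb|)).
exists s => x; rewrite -hs /Yn !YlmE ?sh_ord_le // -/ma -/mb.
rewrite conjC_mul conjC_real -cisN mulrACA -rcM -cisD -mulrBl -intrB.
congr (_%:C%C * _).
have e : (1 - 'X^2 : {poly R}).[cos x.1] = polar_sin x ^+ 2 by rewrite polar_sin_sqr !hornerE.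
rewrite hornerZ !hornerM horner_exp e -exprM.
transitivity (ylm_cst (sh_deg a) ma * ylm_cst (sh_deg b) mb
  * polar_sin x ^+ (`|ma| + `|mb|)
  * ((legD R (sh_deg a) `|ma|).[cos x.1] * (legD R (sh_deg b) `|mb|).[cos x.1])).
  by rewrite exprD; ring.
by rewrite jE exprD; ring.
Qed.

End Harmonics.

(** * Complex square-integrable functions *)

Section ComplexL2.
Context d (T : measurableType d) (R : realType) (mu : {measure set T -> \bar R}).
Variable D : set T.
Hypothesis mD : measurable D.
Local Notation C := R[i].
Local Notation Re := (@complex.Re R).
Local Notation Im := (@complex.Im R).
Implicit Types f g : T -> C.

Lemma cReD (a b : C) : Re (a + b) = Re a + Re b. Proof. by case: a b => ? ? []. Qed.
Lemma cImD (a b : C) : Im (a + b) = Im a + Im b. Proof. by case: a b => ? ? []. Qed.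
Lemma cReM (a b : C) : Re (a * b) = Re a * Re b - Im a * Im b. Proof. by case: a b => ? ? []. Qed.
Lemma cImM (a b : C) : Im (a * b) = Re a * Im b + Im a * Re b. Proof. by case: a b => ? ? []. Qed.
Lemma cReJ (a : C) : Re a^* = Re a. Proof. by case: a. Qed.
Lemma cImJ (a : C) : Im a^* = - Im a. Proof. by case: a. Qed.

Lemma conjC_sum (I : Type) (s : seq I) (F : I -> C) :
  (\sum_(i <- s) F i)^* = \sum_(i <- s) (F i)^*.
Proof. exact: rmorph_sum. Qed.

(** Kept general because it serves twice: on the sphere, for inner products of functions, and on the
    probability space, for covariances of random coefficients. *)
Definition cI f : C :=
  Complex (\int[mu]_(x in D) Re (f x)) (\int[mu]_(x in D) Im (f x)).

Definition cmeasurable f :=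
  measurable_fun D (fun x => Re (f x)) /\ measurable_fun D (fun x => Im (f x)).

Definition sqmod (a : C) : R := Re a ^+ 2 + Im a ^+ 2.

Definition cL2 f := cmeasurable f /\ (\int[mu]_(x in D) (sqmod (f x))%:E < +oo)%E.

Definition cdot f g : C := cI (fun x => f x * (g x)^*).

Definition cintegrable f := mu.-integrable D (EFin \o (fun x => Re (f x))) /\
  mu.-integrable D (EFin \o (fun x => Im (f x))).

Lemma sqmod_ge0 a : 0 <= sqmod a.
Proof. by rewrite addr_ge0 ?sqr_ge0. Qed.

Lemma sqmodE a : (sqmod a)%:C%C = a * a^*.
Proof. by case: a => x y; apply/eqP; rewrite eq_complex /= /sqmod /=; apply/andP; split; apply/eqP; ring. Qed.

Lemma sqmodM a b : sqmod (a * b) = sqmod a * sqmod b.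
Proof. by rewrite /sqmod cReM cImM; ring. Qed.

Lemma cI_D f g : cintegrable f -> cintegrable g -> cI (fun x => f x + g x) = cI f + cI g.
Proof.
move=> [f1 f2] [g1 g2]; apply/eqP; rewrite eq_complex /= -!RintegralD //; apply/andP; split;
  apply/eqP; apply: eq_Rintegral => x _; by rewrite ?cReD ?cImD.
Qed.

Lemma integrableRZ (k : R) (f : T -> R) : mu.-integrable D (EFin \o f) ->
  mu.-integrable D (EFin \o (fun x => k * f x)).
Proof. by move=> h; apply: eq_integrable (integrableZl mD k h) => // x _; rewrite /= EFinM. Qed.

Lemma cI_Z a f : cintegrable f -> cI (fun x => a * f x) = a * cI f.
Proof.
move=> [f1 f2]; apply/eqP; rewrite eq_complex cReM cImM /= -!RintegralZl //.
rewrite -RintegralB //; do ?exact: integrableRZ.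
rewrite -RintegralD //; do ?exact: integrableRZ.
by apply/andP; split; apply/eqP; apply: eq_Rintegral => x _; rewrite ?cReM ?cImM.
Qed.

Lemma cI_conj f : cintegrable f -> cI (fun x => (f x)^*) = (cI f)^*.
Proof.
move=> [f1 f2]; apply/eqP; rewrite eq_complex cReJ cImJ /= -[- _]mulN1r -RintegralZl //.
by apply/andP; split; apply/eqP; apply: eq_Rintegral => x _; rewrite ?cReJ ?cImJ ?mulN1r.
Qed.

Lemma cI_ext f g : (forall x, D x -> f x = g x) -> cI f = cI g.
Proof.
by move=> fg; congr Complex; apply: eq_Rintegral => x /set_mem Dx; rewrite fg.
Qed.

Lemma cmeasurableD f g : cmeasurable f -> cmeasurable g -> cmeasurable (fun x => f x + g x).
Proof.
move=> [f1 f2] [g1 g2]; split.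
  by under eq_fun do rewrite cReD; exact: measurable_funD.
by under eq_fun do rewrite cImD; exact: measurable_funD.
Qed.

Lemma cmeasurableM f g : cmeasurable f -> cmeasurable g -> cmeasurable (fun x => f x * g x).
Proof.
move=> [f1 f2] [g1 g2]; split.
  under eq_fun do rewrite cReM.
  by apply: measurable_funB; exact: measurable_funM.
under eq_fun do rewrite cImM.
by apply: measurable_funD; exact: measurable_funM.
Qed.

Lemma cmeasurable_cst a : cmeasurable (fun=> a).
Proof. by split; exact: measurable_cst. Qed.

Lemma cmeasurableJ f : cmeasurable f -> cmeasurable (fun x => (f x)^*).
Proof.
move=> [f1 f2]; split; first by under eq_fun do rewrite cReJ.
by under eq_fun do rewrite cImJ; exact: measurableT_comp.
Qed.

Lemma measurable_sqmod f : cmeasurable f -> measurable_fun D (fun x => sqmod (f x)).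
Proof. by move=> [f1 f2]; apply: measurable_funD; exact: measurable_funX. Qed.

Lemma cL2_integrable f : cL2 f -> mu.-integrable D (EFin \o (fun x => sqmod (f x))).
Proof.
move=> [mf ff]; apply/integrableP; split.
  by apply/measurable_EFinP; exact: measurable_sqmod.
by under eq_integral do rewrite /= ger0_norm ?sqmod_ge0 //.
Qed.

Lemma dot2_bound (p q p' q' : R) :
  - (p ^+ 2 + q ^+ 2 + (p' ^+ 2 + q' ^+ 2)) <= p * p' + q * q' <= p ^+ 2 + q ^+ 2 + (p' ^+ 2 + q' ^+ 2).
Proof.
have := (sqr_ge0 (p - p'), sqr_ge0 (p + p'), sqr_ge0 (q - q'), sqr_ge0 (q + q')).
have := (sqr_ge0 p, sqr_ge0 p', sqr_ge0 q, sqr_ge0 q').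
move=> [[[? ?] ?] ?] [[[? ?] ?] ?].
apply/andP; split; nra.
Qed.

Lemma cL2_mul_integrable f g : cL2 f -> cL2 g -> cintegrable (fun x => f x * (g x)^*).
Proof.
move=> hf hg; have [m1 m2] := cmeasurableM hf.1 (cmeasurableJ hg.1).
have hfg := integrableD mD (cL2_integrable hf) (cL2_integrable hg).
have key a b : `|Re (a * b^*)| <= `|sqmod a + sqmod b| /\ `|Im (a * b^*)| <= `|sqmod a + sqmod b|.
  rewrite (ger0_norm (addr_ge0 (sqmod_ge0 a) (sqmod_ge0 b))).
  rewrite (cReM a b^* ) (cImM a b^* ) cReJ cImJ /sqmod !ler_norml.
  (* The imaginary part of [a * b^*] is the same dot product with [b] turned by a right angle. *)
  have := dot2_bound (Re a) (Im a) (- Im b) (Re b).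
  rewrite sqrrN [in X in X -> _](addrC (Im b ^+ 2)) !mulrN opprK => h2.
  by split; [exact: dot2_bound|exact: h2].
split; apply: le_integrable hfg => //; try exact/measurable_EFinP; move=> x _.
  by rewrite /= lee_fin; exact: (key _ _).1.
by rewrite /= lee_fin; exact: (key _ _).2.
Qed.

Lemma cL2Z a f : cL2 f -> cL2 (fun x => a * f x).
Proof.
move=> hf; split; first exact: cmeasurableM (cmeasurable_cst a) hf.1.
have /integrableP[_] := integrableRZ (sqmod a) (cL2_integrable hf).
by under eq_integral do rewrite /= ger0_norm ?mulr_ge0 ?sqmod_ge0 // -sqmodM.
Qed.

Lemma cL2D f g : cL2 f -> cL2 g -> cL2 (fun x => f x + g x).
Proof.
move=> hf hg; have mfg := cmeasurableD hf.1 hg.1; split=> //.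
have /integrableP[mi] := integrableD mD (integrableRZ 2 (cL2_integrable hf))
  (integrableRZ 2 (cL2_integrable hg)).
apply: le_lt_trans; apply: ge0_le_integral => //.
- by move=> x _; rewrite lee_fin sqmod_ge0.
- by apply/measurable_EFinP; exact: measurable_sqmod.
- exact: measurableT_comp.
- move=> x _; rewrite /= lee_fin; apply: le_trans (ler_norm _).
  rewrite /sqmod cReD cImD; move: (Re (f x)) (Im (f x)) (Re (g x)) (Im (g x)) => a b a' b'.
  have := (sqr_ge0 (a - a'), sqr_ge0 (b - b')) => -[? ?]; nra.
Qed.

Lemma cL2_0 : cL2 (fun=> 0).
Proof.
split; first exact: cmeasurable_cst.
by under eq_integral do rewrite /sqmod /= expr0n addr0; rewrite integral0 ltry.
Qed.

Lemma cL2_sum (I : Type) (s : seq I) (F : I -> T -> C) :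
  (forall i, cL2 (F i)) -> cL2 (fun x => \sum_(i <- s) F i x).
Proof.
move=> hF; elim: s => [|i s IH]; first by under eq_fun do rewrite big_nil; exact: cL2_0.
by under eq_fun do rewrite big_cons; exact: cL2D.
Qed.

Lemma cdotDl f g k : cL2 f -> cL2 g -> cL2 k -> cdot (fun x => f x + g x) k = cdot f k + cdot g k.
Proof.
move=> hf hg hk; rewrite -cI_D; do ?exact: cL2_mul_integrable.
by apply: cI_ext => x _; rewrite mulrDl.
Qed.

Lemma cdotZl a f k : cL2 f -> cL2 k -> cdot (fun x => a * f x) k = a * cdot f k.
Proof.
move=> hf hk; rewrite -cI_Z; do ?exact: cL2_mul_integrable.
by apply: cI_ext => x _; rewrite mulrA.
Qed.

Lemma cdot_conj f g : cL2 f -> cL2 g -> cdot g f = (cdot f g)^*.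
Proof.
move=> hf hg; rewrite -cI_conj; do ?exact: cL2_mul_integrable.
by apply: cI_ext => x _; rewrite conjC_mul conjCK mulrC.
Qed.

Lemma cdot_suml (I : Type) (s : seq I) (a : I -> C) (F : I -> T -> C) k :
  (forall i, cL2 (F i)) -> cL2 k ->
  cdot (fun x => \sum_(i <- s) a i * F i x) k = \sum_(i <- s) a i * cdot (F i) k.
Proof.
move=> hF hk; have hz i : cL2 (fun x => a i * F i x) by exact: cL2Z.
elim: s => [|i s IH].
  rewrite big_nil; transitivity (cdot (fun x => 0 * (0 : C)) k); last by rewrite (cdotZl 0 cL2_0) ?mul0r.
  by apply: cI_ext => x _; rewrite big_nil mulr0.
rewrite big_cons -IH -cdotZl // -cdotDl //; last exact: cL2_sum.
by apply: cI_ext => x _; rewrite big_cons.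
Qed.

Lemma cdot_sumr (I : Type) (s : seq I) (a : I -> C) (F : I -> T -> C) k :
  (forall i, cL2 (F i)) -> cL2 k ->
  cdot k (fun x => \sum_(i <- s) a i * F i x) = \sum_(i <- s) (a i)^* * cdot k (F i).
Proof.
move=> hF hk; rewrite (@cdot_conj _ k) //; last by apply: cL2_sum => i; exact: cL2Z.
rewrite cdot_suml // conjC_sum; apply: eq_bigr => i _.
by rewrite conjC_mul -cdot_conj.
Qed.

Lemma cdot_normE f : cL2 f -> (\int[mu]_(x in D) (sqmod (f x))%:E)%E = (Re (cdot f f))%:E.
Proof.
move=> hf; rewrite /= /Rintegral.
have e x : Re (f x * (f x)^*) = sqmod (f x) by rewrite -sqmodE.
under [in RHS]eq_integral do rewrite e.
by rewrite fineK //; apply: integrable_fin_num => //; exact: cL2_integrable.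
Qed.

Lemma cdot_self f : cL2 f -> cdot f f = (Re (cdot f f))%:C%C.
Proof.
move=> hf; apply/eqP; rewrite eq_complex /= eqxx /=.
have e x : Im (f x * (f x)^*) = 0 by rewrite -sqmodE.
by rewrite /Rintegral; under eq_integral do rewrite e; rewrite integral0.
Qed.

Lemma cdot_ge0 f : 0 <= Re (cdot f f).
Proof.
by apply: Rintegral_ge0 => x _; rewrite -sqmodE /= sqmod_ge0.
Qed.

End ComplexL2.

(** * Separable integrals over the sphere *)

Section ProductIntegral.
Context d1 d2 (T1 : measurableType d1) (T2 : measurableType d2) (R : realType).
Context (m1 : {sigma_finite_measure set T1 -> \bar R})
        (m2 : {sigma_finite_measure set T2 -> \bar R}).
Variables (f : T1 -> R) (g : T2 -> R).
Hypothesis intf : m1.-integrable setT (EFin \o f).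
Hypothesis intg : m2.-integrable setT (EFin \o g).

Lemma integrable_prodM : (m1 \x m2)%E.-integrable setT (EFin \o (fun z => f z.1 * g z.2)).
Proof.
have /measurable_EFinP mf := measurable_int m1 intf.
have /measurable_EFinP mg := measurable_int m2 intg.
apply/integrable12ltyP.
  apply/measurable_EFinP; apply: measurable_funM.
    by apply: (measurableT_comp mf); exact: measurable_fst.
  by apply: (measurableT_comp mg); exact: measurable_snd.
have absg : m2.-integrable setT (EFin \o (fun y => `|g y|)) by exact: integrable_norm.
have absf : m1.-integrable setT (EFin \o (fun x => `|f x|)) by exact: integrable_norm.
rewrite (_ : (fun x => _) = (fun x => `|f x|%:E * \int[m2]_y (`|g y|)%:E)%E); last first.
  apply/funext => x; rewrite -integralZl //; apply: eq_integral => y _.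
  by rewrite /= normrM EFinM.
have RintE d (T : measurableType d) (m : measure T R) (k : T -> R) :
    m.-integrable setT (EFin \o k) -> (\int[m]_y (k y)%:E = (\int[m]_y k y)%:E)%E.
  by move=> ik; rewrite /Rintegral fineK //; exact: integrable_fin_num.
by rewrite (RintE _ _ _ _ absg) integralZr // (RintE _ _ _ _ absf) -EFinM ltry.
Qed.

Lemma Rintegral_prodM : \int[(m1 \x m2)%E]_z (f z.1 * g z.2) = (\int[m1]_x f x) * (\int[m2]_y g y).
Proof.
rewrite {1}/Rintegral -(integral12_prod_meas1 integrable_prodM) /fubini_F /=.
have -> : (\int[m1]_x \int[m2]_y (f x * g y)%:E = \int[m1]_x ((f x)%:E * \int[m2]_y (g y)%:E))%E.
  by apply: eq_integral => x _; rewrite -integralZl.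
have -> : (\int[m2]_y (g y)%:E = (\int[m2]_y g y)%:E)%E.
  by rewrite /Rintegral fineK //; exact: integrable_fin_num.
rewrite integralZr // fineM //; exact: integrable_fin_num.
Qed.

End ProductIntegral.

(** * Reduction of sphere integrals to one variable *)

Section SphereIntegral.
Variable R : realType.
Local Notation leb := (@lebesgue_measure R).
Local Notation L2 := (@leb2 R).

Lemma measurable_S2dom : measurable (@S2dom R : set (measurableTypeR R * measurableTypeR R)%type).
Proof. by apply: measurableX; exact: measurable_itv. Qed.

Section Separable.
Variables (A B : R -> R) (cA : continuous A) (cB : continuous B).

Let fA : R -> R := A \_ `[0, pi]%classic.
Let fB : R -> R := B \_ `[0, 2 * pi[%classic.

Let sepE : (fun x => A x.1 * B x.2) \_ (@S2dom R) = (fun x : R * R => fA x.1 * fB x.2).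
Proof.
apply/funext => -[a b]; rewrite /fA /fB !patchE /= /S2dom.
by rewrite in_setX /=; case: (_ \in _); case: (_ \in _); rewrite ?mul0r ?mulr0.
Qed.

Let intA : leb.-integrable `[0, pi]%classic (EFin \o A).
Proof.
apply: continuous_compact_integrable; first exact: segment_compact.
exact: continuous_subspaceT.
Qed.

Let intB' : leb.-integrable `[0, 2 * pi]%classic (EFin \o B).
Proof.
apply: continuous_compact_integrable; first exact: segment_compact.
exact: continuous_subspaceT.
Qed.

Let intB : leb.-integrable `[0, 2 * pi[%classic (EFin \o B).
Proof.
apply: integrableS intB' => //.
by move=> x /=; rewrite !in_itv /= => /andP[-> /ltW].
Qed.

Lemma integrable_separable : L2.-integrable (@S2dom R) (EFin \o (fun x => A x.1 * B x.2)).
Proof.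
apply/integrable_mkcond; first exact: measurable_S2dom.
rewrite restrict_EFin sepE.
apply: (@integrable_prodM _ _ _ _ _ leb leb); rewrite /fA /fB -restrict_EFin.
  exact: (@integrable_mkcond _ _ _ leb _ (EFin \o A) (measurable_itv `[0, pi])).1 intA.
exact: (@integrable_mkcond _ _ _ leb _ (EFin \o B) (measurable_itv `[0, 2 * pi[)).1 intB.
Qed.

Lemma Rintegral_separable : \int[L2]_(x in @S2dom R) (A x.1 * B x.2) =
  (\int[leb]_(x in `[0, pi]%classic) A x) * (\int[leb]_(x in `[0, 2 * pi]%classic) B x).
Proof.
(* The endpoint [2 * pi] is a null set; the closed interval is the form suited to the fundamental
   theorem of calculus. *)
rewrite -(Rintegral_itv_bndo_bndc intB) Rintegral_mkcond sepE.
rewrite [X in _ = X * _]Rintegral_mkcond [X in _ = _ * X]Rintegral_mkcond.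
apply: (@Rintegral_prodM _ _ _ _ _ leb leb); rewrite /fA /fB -restrict_EFin.
  exact: (@integrable_mkcond _ _ _ leb _ (EFin \o A) (measurable_itv `[0, pi])).1 intA.
exact: (@integrable_mkcond _ _ _ leb _ (EFin \o B) (measurable_itv `[0, 2 * pi[)).1 intB.
Qed.

End Separable.

Lemma Rintegral_FTC (f F : R -> R) (a b : R) : a < b -> continuous f ->
  (forall x, is_derive x (1 : R) F (f x)) ->
  \int[leb]_(x in `[a, b]%classic) f x = F b - F a.
Proof.
move=> ab cf dF; have cF x : F y @[y --> x] --> F x.
  by apply: differentiable_continuous; apply/derivable1_diffP; have [] := dF x.
rewrite /Rintegral (@continuous_FTC2 _ f F) //=.
- exact: continuous_subspaceT.
- split; first by move=> x _; have [] := dF x.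
    exact/cvg_at_right_filter/cF.
  exact/cvg_at_left_filter/cF.
- by move=> x _; rewrite derive1E; have [_ ->] := dF x.
Qed.

Lemma continuous_hornerC (p : {poly R}) : continuous (fun t => p.[cos t]).
Proof. by move=> t; apply: continuous_comp; [exact: continuous_cos|exact: continuous_horner]. Qed.

(** The substitution x = cos t, done through the explicit antiderivative - P(cos t) with P =
    [pprim p]. *)
Lemma Rintegral_poly_cos (p : {poly R}) :
  \int[leb]_(t in `[0, pi]%classic) (p.[cos t] * sin t) = pint p.
Proof.
have dF (t : R) : is_derive t (1 : R) (fun t => - (pprim p).[cos t]) (p.[cos t] * sin t).
  have dp : is_derive (cos t) (1 : R) (horner (pprim p)) p.[cos t].
    rewrite -[in p.[_]](deriv_pprim p) derivE derive1E.
    by apply: DeriveDef => //; exact: derivable_horner.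
  have dc := @is_derive1_comp _ (horner (pprim p)) (@cos R) t _ _ dp (is_derive_cos t).
  apply: (is_derive_eq (is_deriveN dc)).
  by rewrite /GRing.scale /=; ring.
rewrite (Rintegral_FTC (pi_gt0 R) _ dF).
  by rewrite cospi cos0 /pint opprK addrC.
by move=> t; apply: cvgM; [exact: continuous_hornerC|exact: continuous_sin].
Qed.

Lemma trig_int2pi (m : int) : cos (m%:~R * (2 * pi)) = 1 :> R /\ sin (m%:~R * (2 * pi)) = 0 :> R.
Proof.
have nat_case n : cos (n%:R * (2 * pi)) = 1 :> R /\ sin (n%:R * (2 * pi)) = 0 :> R.
  have -> : n%:R * (2 * pi) = 0 + (pi *+ 2) *+ n :> R by rewrite add0r -[RHS]mulr_natl -[pi *+ 2]mulr_natl.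
  by rewrite (periodicn (@cosD2pi R)) (periodicn (@sinD2pi R)) cos0 sin0.
case: m => n; first exact: nat_case.
have [c0 s0] := nat_case n.+1.
by rewrite NegzE mulrNz mulNr cosN sinN c0 s0 oppr0.
Qed.

Lemma is_derive_mull (a t : R) : is_derive t (1 : R) (fun t => a * t) a.
Proof.
apply: (is_derive_eq (is_deriveZ a (is_derive_id t (1 : R)))).
by rewrite /GRing.scale /= mulr1.
Qed.

Lemma Rintegral_cos_int (m : int) :
  \int[leb]_(t in `[0, 2 * pi]%classic) cos (m%:~R * t) = if m == 0 then 2 * pi else 0.
Proof.
have p2 : 0 < 2 * pi :> R by rewrite mulr_gt0 // pi_gt0.
case: eqP => [->|/eqP m0].
  under eq_Rintegral do rewrite mul0r cos0.
  by rewrite Rintegral_cst //= lebesgue_measure_itv /= lte_fin p2 mul1r /= subr0.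
have m1 : m%:~R != 0 :> R by rewrite intr_eq0.
have dF (t : R) : is_derive t (1 : R) (fun t => (m%:~R)^-1 * sin (m%:~R * t)) (cos (m%:~R * t)).
  have dm := is_derive_mull m%:~R t.
  have ds := @is_derive1_comp _ (@sin R) _ t _ _ (is_derive_sin _) dm.
  apply: (is_derive_eq (is_deriveZ (m%:~R)^-1 ds)).
  by rewrite /GRing.scale /=; field.
rewrite (Rintegral_FTC p2 _ dF).
  by rewrite (trig_int2pi m).2 !mulr0 sin0 mulr0 subrr.
by move=> t; apply: continuous_comp; [exact: mulrl_continuous|exact: continuous_cos].
Qed.

Lemma Rintegral_sin_int (m : int) :
  \int[leb]_(t in `[0, 2 * pi]%classic) sin (m%:~R * t) = 0.
Proof.
have p2 : 0 < 2 * pi :> R by rewrite mulr_gt0 // pi_gt0.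
have [->|m0] := eqVneq m 0.
  by under eq_Rintegral do rewrite mul0r sin0; rewrite Rintegral_cst //= mul0r.
have m1 : m%:~R != 0 :> R by rewrite intr_eq0.
have dF (t : R) : is_derive t (1 : R) (fun t => - (m%:~R)^-1 * cos (m%:~R * t)) (sin (m%:~R * t)).
  have dm := is_derive_mull m%:~R t.
  have ds := @is_derive1_comp _ (@cos R) _ t _ _ (is_derive_cos _) dm.
  apply: (is_derive_eq (is_deriveZ (- (m%:~R)^-1) ds)).
  by rewrite /GRing.scale /=; field.
rewrite (Rintegral_FTC p2 _ dF).
  by rewrite (trig_int2pi m).1 !mulr0 cos0 subrr.
by move=> t; apply: continuous_comp; [exact: mulrl_continuous|exact: continuous_sin].
Qed.

End SphereIntegral.

(** * Orthonormality of the spherical harmonics *)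

Section SphereL2.
Variable R : realType.
Local Notation C := R[i].
Local Notation leb := (@lebesgue_measure R).
Local Notation L2 := (@leb2 R).
Local Notation Re := (@complex.Re R).
Local Notation Im := (@complex.Im R).
Local Notation S2 := (@S2dom R).
Implicit Types f g k : R * R -> C.

Let mS := @measurable_S2dom R.

(* Multiplying functions by [sqrt (sin theta)] turns the inner product of the sphere
   into the unweighted one [cdot]. *)
Definition sin_wt (x : R * R) : C := (Num.sqrt (sin x.1))%:C%C.

Definition sl2 f := cL2 L2 S2 (fun x => f x * sin_wt x).

Lemma sin_S2_ge0 x : S2 x -> 0 <= sin x.1.
Proof. by move=> [/= + _]; rewrite in_itv /= => x1; exact: sin_ge0_pi. Qed.

Lemma ReMr (a : C) (t : R) : Re (a * t%:C%C) = Re a * t.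
Proof. by rewrite cReM /= mulr0 subr0. Qed.

Lemma ImMr (a : C) (t : R) : Im (a * t%:C%C) = Im a * t.
Proof. by rewrite cImM /= mulr0 add0r. Qed.

Lemma sin_wt_sqr x : S2 x -> sin_wt x * sin_wt x = (sin x.1)%:C%C.
Proof. by move=> /sin_S2_ge0 s0; rewrite -rcM -expr2 sqr_sqrtr. Qed.

Lemma cintE f : cint f = cI L2 S2 (fun x => f x * (sin x.1)%:C%C).
Proof. by congr Complex; apply: eq_Rintegral => x _; rewrite ?ReMr ?ImMr. Qed.

Lemma cint_ext f g : (forall x, S2 x -> f x = g x) -> cint f = cint g.
Proof. by move=> fg; rewrite !cintE; apply: cI_ext => x Sx; rewrite fg. Qed.

Lemma sinnerE f g : sinner f g = cdot L2 S2 (fun x => f x * sin_wt x) (fun x => g x * sin_wt x).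
Proof.
rewrite /sinner cintE; apply: cI_ext => x Sx.
by rewrite conjC_mul conjC_real mulrACA sin_wt_sqr.
Qed.

Lemma sqmod_wt f x : S2 x -> sqmod (f x * sin_wt x) = sqmod (f x) * sin x.1.
Proof.
move=> /sin_S2_ge0 s0; rewrite sqmodM; congr (_ * _).
by rewrite /sqmod /= expr0n addr0 sqr_sqrtr.
Qed.

Lemma sqnormE f : sqnorm f = (\int[L2]_(x in S2) (sqmod (f x * sin_wt x))%:E)%E.
Proof. by apply: eq_integral => x /set_mem Sx; rewrite sqmod_wt. Qed.

Lemma cmeasurable_sin_wt : cmeasurable S2 sin_wt.
Proof.
split; last exact: measurable_cst.
apply: measurable_funTS => /=.
have m : measurable_fun setT (fun t : R => Num.sqrt (sin t)).
  apply: continuous_measurable_fun => t.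
  by apply: continuous_comp; [exact: continuous_sin|exact: sqrt_continuous].
by apply: (measurableT_comp m); exact: measurable_fst.
Qed.

Lemma sl2_of_sqnorm f : cmeasurable S2 f -> (sqnorm f < +oo)%E -> sl2 f.
Proof.
move=> mf; rewrite sqnormE; split=> //.
exact: cmeasurableM mf cmeasurable_sin_wt.
Qed.

Lemma sl2Z a f : sl2 f -> sl2 (fun x => a * f x).
Proof. by move=> hf; have := cL2Z mS a hf; rewrite /sl2; under eq_fun do rewrite mulrA. Qed.

Lemma sl2D f g : sl2 f -> sl2 g -> sl2 (fun x => f x + g x).
Proof. by move=> hf hg; have := cL2D mS hf hg; rewrite /sl2; under eq_fun do rewrite -mulrDl. Qed.

Lemma sl2_sum (I : Type) (s : seq I) (F : I -> R * R -> C) :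
  (forall i, sl2 (F i)) -> sl2 (fun x => \sum_(i <- s) F i x).
Proof.
move=> hF; have := cL2_sum mS s hF.
by rewrite /sl2; under eq_fun do rewrite -mulr_suml.
Qed.

Lemma sinner_suml (I : Type) (s : seq I) (a : I -> C) (F : I -> R * R -> C) g :
  (forall i, sl2 (F i)) -> sl2 g ->
  sinner (fun x => \sum_(i <- s) a i * F i x) g = \sum_(i <- s) a i * sinner (F i) g.
Proof.
move=> hF hg; rewrite sinnerE; under [X in cdot _ _ X _]eq_fun do rewrite mulr_suml.
under [X in cdot _ _ X _]eq_fun do under eq_bigr do rewrite -mulrA.
by rewrite (cdot_suml mS) //; apply: eq_bigr => i _; rewrite sinnerE.
Qed.

Lemma sinner_sumr (I : Type) (s : seq I) (a : I -> C) (F : I -> R * R -> C) f :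
  (forall i, sl2 (F i)) -> sl2 f ->
  sinner f (fun x => \sum_(i <- s) a i * F i x) = \sum_(i <- s) (a i)^* * sinner f (F i).
Proof.
move=> hF hf; rewrite sinnerE; under [X in cdot _ _ _ X]eq_fun do rewrite mulr_suml.
under [X in cdot _ _ _ X]eq_fun do under eq_bigr do rewrite -mulrA.
by rewrite (cdot_sumr mS) //; apply: eq_bigr => i _; rewrite sinnerE.
Qed.

Lemma sinnerDl f g k : sl2 f -> sl2 g -> sl2 k ->
  sinner (fun x => f x + g x) k = sinner f k + sinner g k.
Proof.
move=> hf hg hk; rewrite !sinnerE -(cdotDl mS) //.
by under [X in cdot _ _ X _]eq_fun do rewrite mulrDl.
Qed.

Lemma sqnorm_sinner f : sl2 f -> sqnorm f = (Re (sinner f f))%:E.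
Proof. by move=> hf; rewrite sqnormE sinnerE (cdot_normE mS). Qed.

Definition Yamp n (t : R) : R := ylm_cst R (sh_deg n) (sh_ord n)
  * Num.sqrt (1 - cos t ^+ 2) ^+ `|sh_ord n| * (legD R (sh_deg n) `|sh_ord n|).[cos t].

Lemma YnE n x : Yn n x = (Yamp n x.1)%:C%C * cis ((sh_ord n)%:~R * x.2).
Proof. by rewrite /Yn YlmE ?sh_ord_le. Qed.

Lemma continuous_Yamp n : continuous (Yamp n).
Proof.
move=> t; apply: cvgM; last exact: continuous_hornerC.
apply: cvgM; first exact: cvg_cst.
apply: (@continuous_comp _ _ _ (fun t => Num.sqrt (1 - cos t ^+ 2)) (fun u => u ^+ _)); last first.
  exact: exprn_continuous.
have e : (fun t : R => 1 - cos t ^+ 2) = (fun t => (1 - 'X^2).[cos t]).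
  by apply/funext => u; rewrite !hornerE.
apply: continuous_comp; last exact: sqrt_continuous.
rewrite e; exact: continuous_hornerC.
Qed.

Lemma cint_separable (A : R -> R) (m : int) : continuous A ->
  cint (fun x => (A x.1)%:C%C * cis (m%:~R * x.2)) =
  ((\int[leb]_(t in `[0, pi]%classic) (A t * sin t)) * (if m == 0 then 2 * pi else 0))%:C%C.
Proof.
move=> cA; have cAs : continuous (fun t => A t * sin t).
  by move=> t; apply: cvgM; [exact: cA|exact: continuous_sin].
congr Complex.
  rewrite /sint -Rintegral_cos_int -Rintegral_separable //.
    by apply: eq_Rintegral => x _; rewrite cReM /= mul0r subr0 mulrAC.
  by move=> t; apply: continuous_comp; [exact: mulrl_continuous|exact: continuous_cos].
rewrite /sint; transitivity (\int[L2]_(x in S2) ((A x.1 * sin x.1) * sin (m%:~R * x.2))).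
  by apply: eq_Rintegral => x _; rewrite cImM /= mul0r addr0 mulrAC.
rewrite (@Rintegral_separable _ (fun t => A t * sin t) (fun t => sin (m%:~R * t))) //.
  by rewrite Rintegral_sin_int mulr0.
by move=> t; apply: continuous_comp; [exact: mulrl_continuous|exact: continuous_sin].
Qed.

Lemma cmeasurable_Yn n (D : set (measurableTypeR R * measurableTypeR R)) : cmeasurable D (Yn n).
Proof.
have cY := @continuous_Yamp n.
have mA : measurable_fun D (fun x => Yamp n x.1).
  apply: measurable_funTS; apply: (measurableT_comp (continuous_measurable_fun cY)).
  exact: measurable_fst.
have mm (F : R -> R) : continuous F -> measurable_fun D (fun x => F ((sh_ord n)%:~R * x.2)).
  move=> cF; apply: measurable_funTS; apply: (measurableT_comp (continuous_measurable_fun cF)).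
  by apply: measurable_funM => //; exact: measurable_snd.
split; [under eq_fun do rewrite YnE cReM /= mul0r subr0|under eq_fun do rewrite YnE cImM /= mul0r addr0].
  by apply: measurable_funM => //; apply: mm; exact: continuous_cos.
by apply: measurable_funM => //; apply: mm; exact: continuous_sin.
Qed.

Lemma sl2_Yn n : sl2 (Yn n).
Proof.
have cY := @continuous_Yamp n.
apply: sl2_of_sqnorm; first exact: cmeasurable_Yn.
have cA : continuous (fun t => Yamp n t ^+ 2 * sin t).
  move=> t; apply: cvgM; last exact: continuous_sin.
  by apply: (@continuous_comp _ _ _ (Yamp n) (fun u => u ^+ 2)); [exact: cY|exact: exprn_continuous].
have cB : continuous (fun _ : R => 1 : R) by exact: cst_continuous.
apply: le_lt_trans (integrable_lty mS (integrable_separable cA cB)).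
rewrite le_eqVlt; apply/orP; left; apply/eqP.
apply: eq_integral => x _; congr EFin; rewrite mulr1; congr (_ * _).
by rewrite YnE cReM cImM /= !mul0r subr0 addr0 !exprMn -mulrDr cos2Dsin2 mulr1.
Qed.

(** Distinct orders are separated by the integral over phi. For equal orders the integral over theta
    becomes a [pint], where distinct degrees are orthogonal; degree and order together determine the
    index. *)
Lemma sinner_Yn a b : sinner (Yn a) (Yn b) = (a == b)%:R :> C.
Proof.
have cA : continuous (fun t => Yamp a t * Yamp b t).
  by move=> t; apply: cvgM; exact: continuous_Yamp.
rewrite /sinner (@cint_ext _ (fun x => (Yamp a x.1 * Yamp b x.1)%:C%C *
    cis ((sh_ord a - sh_ord b)%:~R * x.2))); last first.
  move=> x _; rewrite !YnE conjC_mul conjC_real -cisN mulrACA -rcM -cisD.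
  by rewrite -mulrBl -intrB.
rewrite (cint_separable _ cA) subr_eq0.
have [eo|no] := eqVneq (sh_ord a) (sh_ord b); last first.
  by have [ab|//] := eqVneq a b; [rewrite ab eqxx in no|rewrite mulr0].
pose k := `|sh_ord b|%N; have kb : (k <= sh_deg b)%N := sh_ord_le b.
have ka : (k <= sh_deg a)%N by rewrite /k -eo sh_ord_le.
set c := ylm_cst R (sh_deg a) (sh_ord a) * ylm_cst R (sh_deg b) (sh_ord b).
have -> : \int[leb]_(t in `[0, pi]%classic) (Yamp a t * Yamp b t * sin t) =
    c * ((-1) ^+ k * pint (('X^2 - 1) ^+ k * legD R (sh_deg a) k * legD R (sh_deg b) k)).
  rewrite mulrA -pintZ -Rintegral_poly_cos; apply: eq_Rintegral => t _; congr (_ * _).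
  rewrite /Yamp eo -/k hornerZ !hornerM horner_exp.
  (* At cos t the weight [u] is - sin^2, whence the [(-1) ^+ k] carried along since [legD_norm]. *)
  have -> : ('X^2 - 1 : {poly R}).[cos t] = - Num.sqrt (1 - cos t ^+ 2) ^+ 2.
    by rewrite (polar_sin_sqr (t, 0)) !hornerE /=; ring.
  have -> (u : R) : (- u ^+ 2) ^+ k = (-1) ^+ k * (u ^+ k * u ^+ k).
    by rewrite [LHS]exprNn -exprM mul2n -addnn exprD.
  by rewrite -[LHS]mul1r -[X in X * _ = _](sqrr_sign R k) /c eo; ring.
have [ab|ab] := eqVneq a b.
  rewrite ab in c *; rewrite /c -expr2 ylm_cst_sqr mulrAC.
  by have := @ylm_amp_sqr R _ _ kb; rewrite -/k => ->.
rewrite legD_ortho //; first by rewrite !mulr0 mul0r.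
apply: contraNN ab => /eqP ed; apply/eqP.
by rewrite -(sh_idxK a) -(sh_idxK b) ed eo.
Qed.

End SphereL2.

(** * Expansion of the SLSHT distribution *)

Section Slsht.
Variable R : realType.
Local Notation C := R[i].
Local Notation Re := (@complex.Re R).
Local Notation Im := (@complex.Im R).
Local Notation S2 := (@S2dom R).
Implicit Types f g h : R * R -> C.

Lemma sum_ord_pick (K j : nat) (F : nat -> C) : (j < K)%N ->
  \sum_(c < K) (c == j :> nat)%:R * F c = F j.
Proof.
move=> jK; rewrite (bigD1 (Ordinal jK)) //= eqxx mul1r big1 ?addr0 // => i ij.
by rewrite (negbTE (_ : (i : nat) != j)) ?mul0r //; apply: contraNneq ij => ij; apply/eqP/val_inj.
Qed.

Lemma cint_YfY r n f : cint (fun x => Yn r x * f x * (Yn n x)^*) =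
  sinner f (fun x => Yn n x * (Yn r x)^*).
Proof.
by apply: cint_ext => x _; rewrite conjC_mul conjCK [Yn r x * f x]mulrC -mulrA [Yn r x * _]mulrC.
Qed.

Lemma sl2_YY n r : sl2 (fun x => Yn n x * (Yn r x : C)^*).
Proof.
have [s hs] := mulJ_in_sh_span R n r.
rewrite (_ : (fun x => _) = (fun x => \sum_(p <- s) p.1%:C%C * Yn p.2 x)); last exact/funext.
by apply: sl2_sum => p; apply: sl2Z; exact: sl2_Yn.
Qed.

(** By orthonormality, [triple R c r n] is the total coefficient of [Yn c] in the finite real
    expansion of [Yn n x * (Yn r x)^*]; [K] bounds the indices occurring there, hence does not
    depend on [f]. *)
Lemma triple_expand r n : exists K, [/\
  forall c, (K <= c)%N -> triple R c r n = 0,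
  forall c, (triple R c r n)^* = triple R c r n &
  forall f, sl2 f -> cint (fun x => Yn r x * f x * (Yn n x)^*) =
    \sum_(c < K) triple R c r n * shcoef f c].
Proof.
have [s hs] := mulJ_in_sh_span R n r.
have sE f : sl2 f -> cint (fun x => Yn r x * f x * (Yn n x)^*) =
    \sum_(p <- s) p.1%:C%C * shcoef f p.2.
  move=> hf; rewrite cint_YfY (_ : (fun x => _) = (fun x => \sum_(p <- s) p.1%:C%C * Yn p.2 x)).
    rewrite (sinner_sumr _ (fun p : R * nat => p.1%:C%C)) //; last by move=> p; exact: sl2_Yn.
    by apply: eq_bigr => p _; rewrite conjC_real.
  exact/funext.
have tE c : triple R c r n = \sum_(p <- s) p.1%:C%C * (c == p.2)%:R.
  by rewrite /triple sE; [apply: eq_bigr => p _; rewrite /shcoef sinner_Yn|exact: sl2_Yn].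
have ltK p : p \in s -> (p.2 < (\max_(p <- s) p.2).+1)%N.
  by move=> ps; rewrite ltnS; exact: (@leq_bigmax_seq _ s xpredT (fun p : R * nat => p.2) p ps).
exists (\max_(p <- s) p.2).+1; split=> [c Kc|c|f hf].
- rewrite tE big1_seq // => p /= ps.
  by rewrite gtn_eqF ?mulr0 // (leq_trans (ltK _ ps)).
- by rewrite tE conjC_sum; apply: eq_bigr => p _; rewrite conjC_mul conjC_real conjC_nat.
rewrite sE //; under [RHS]eq_bigr do rewrite tE mulr_suml.
rewrite exchange_big /=; apply: eq_big_seq => p ps.
under eq_bigr do rewrite -mulrA.
by rewrite -mulr_sumr sum_ord_pick ?ltK.
Qed.

Definition win_fac h r : C := (-1) ^+ `|sh_ord r|
  * (Num.sqrt (4 * pi / (2 * (sh_deg r)%:R + 1)))%:C%C * shcoef h (sh_deg r * sh_deg r + sh_deg r).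

(** The coefficient of [Yn r] in the distribution, as an integral rather than a sum over [c]:
    additivity in [f] is then immediate, and the sum is recovered for square-integrable [f]. *)
Definition slsht_coef h f r n : C :=
  win_fac h r * cint (fun x => Yn (sh_neg r) x * f x * (Yn n x)^*).

Lemma HcoefE h c r n : Hcoef h c r n = win_fac h r * triple R c (sh_neg r) n.
Proof. by []. Qed.

(** At order 0 the phase factor is [cis 0], so the harmonic is real like the window. *)
Lemma shcoef_zonal_real h p : (forall x, Im (h x) = 0) ->
  (shcoef h (p * p + p))^* = shcoef h (p * p + p).
Proof.
move=> hR; have oE : sh_ord (p * p + p) = 0.
  have e : (p * p + p)%N = sh_idx p 0 by rewrite /sh_idx addr0.
  by rewrite (sh_idxE _ e).
apply/eqP; rewrite eq_complex cReJ cImJ eqxx andTb.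
suff -> : Im (shcoef h (p * p + p)) = 0 by rewrite oppr0.
rewrite /= /sint; under eq_Rintegral => x _.
  rewrite YnE oE mul0r conjC_mul conjC_real cImM hR mul0r addr0 cImM /= sin0 oppr0 !mulr0 mul0r.
  rewrite addr0 mulr0 mul0r.
  over.
by rewrite Rintegral_cst ?mul0r //; exact: measurable_S2dom.
Qed.

Lemma Hcoef_real h c r n : (forall x, Im (h x) = 0) -> (Hcoef h c r n)^* = Hcoef h c r n.
Proof.
move=> hR; have [K [_ tR _]] := triple_expand (sh_neg r) n.
rewrite HcoefE /win_fac !conjC_mul tR shcoef_zonal_real // conjC_real.
by rewrite -rc_sign conjC_real.
Qed.

Lemma slsht_coef_expand h r n : exists K,
  (forall c, (K <= c)%N -> Hcoef h c r n = 0) /\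
  (forall f, sl2 f -> slsht_coef h f r n = \sum_(c < K) Hcoef h c r n * shcoef f c).
Proof.
have [K [t0 _ tE]] := triple_expand (sh_neg r) n.
exists K; split=> [c Kc|f hf]; first by rewrite HcoefE t0 ?mulr0.
rewrite /slsht_coef tE // mulr_sumr; apply: eq_bigr => c _.
by rewrite HcoefE mulrA.
Qed.

(** The rotated window involves the conjugate of [Yn r y], while an expansion in [Yn r y] is wanted.
    Replacing [r] by [sh_neg r], which preserves the degree and so permutes the range of summation,
    removes the conjugate. This is where the sign (-1)^q and the order -q in [H] come from. *)
Lemma slshtE Lh h f y n : sl2 f ->
  slsht Lh h f y n = \sum_(r < Lh.+1 ^ 2) slsht_coef h f r n * Yn r y.
Proof.
move=> hf; pose a (r : nat) : C := (Num.sqrt (4 * pi / (2 * (sh_deg r)%:R + 1)))%:C%C * (Yn r y)^*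
  * shcoef h (sh_deg r * sh_deg r + sh_deg r).
have -> : slsht Lh h f y n =
    sinner f (fun x => \sum_(r < Lh.+1 ^ 2) (a r)^* * (Yn n x * (Yn r x)^*)).
  apply: cint_ext => x _; rewrite /rot -mulrA [RHS]mulrC conjC_sum mulr_suml.
  have c3 (u v w : C) : (u^* * (v * w^*))^* = u * (v^* * w).
    by rewrite !conjC_mul !conjCK.
  rewrite mulr_suml; apply: eq_bigr => r _; rewrite c3 /a.
  by move: (Yn r x) (Yn r y)^* (Yn n x)^* => u v w; ring.
rewrite (sinner_sumr _ (fun r : 'I_(Lh.+1 ^ 2) => (a r)^*)) //; last by move=> r; exact: sl2_YY.
have neg_lt (r : 'I_(Lh.+1 ^ 2)) : (sh_neg r < Lh.+1 ^ 2)%N.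
  by rewrite sh_deg_leE sh_deg_neg -sh_deg_leE.
have negK : involutive (fun r : 'I_(Lh.+1 ^ 2) => Ordinal (neg_lt r)).
  by move=> r; apply: val_inj; rewrite /= sh_negK.
rewrite (reindex_inj (inv_inj negK)) /=; apply: eq_bigr => r _.
have c2 (k : nat) (u : C) : ((-1) ^+ k * u^*)^* = (-1) ^+ k * u.
  by rewrite conjC_mul conjCK -rc_sign conjC_real.
rewrite conjCK -cint_YfY /slsht_coef /a sh_deg_neg Yn_neg c2 /win_fac.
by move: (Yn r y) (cint _) => u v; ring.
Qed.

Lemma shcoef_sum N (a : nat -> C) r : (r < N)%N ->
  shcoef (fun y => \sum_(i < N) a i * Yn i y) r = a r.
Proof.
move=> rN; rewrite /shcoef (sinner_suml _ (fun i : 'I_N => a i)); try by move=> *; exact: sl2_Yn.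
under eq_bigr do rewrite sinner_Yn mulrC.
by rewrite sum_ord_pick.
Qed.

Lemma sqnorm_sum N (a : nat -> C) :
  sqnorm (fun y => \sum_(i < N) a i * Yn i y) = (\sum_(i < N) sqmod (a i))%:E.
Proof.
have hY (i : 'I_N) : sl2 (Yn i) by exact: sl2_Yn.
have hs : sl2 (fun y => \sum_(i < N) a i * Yn i y) by apply: sl2_sum => i; exact: sl2Z.
rewrite sqnorm_sinner // (sinner_suml _ (fun i : 'I_N => a i)) //; congr EFin.
transitivity (Re (\sum_(i < N) (sqmod (a i))%:C%C)).
  congr Re; apply: eq_bigr => i _.
  rewrite (sinner_sumr _ (fun i : 'I_N => a i)) // sqmodE; congr (_ * _).
  under eq_bigr do rewrite sinner_Yn eq_sym mulrC.
  by rewrite (@sum_ord_pick _ i (fun j => (a j)^*)).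
by rewrite -(rmorph_sum (real_complex R)).
Qed.

Lemma ess_summandE Lh h f g (zh : nat -> nat -> C) n : sl2 f -> sl2 g ->
  sqnorm (fun y => conv_bl Lh (fun y' => slsht Lh h f y' n) (zeta_fun Lh zh n) y
                   - slsht Lh h g y n) =
  (\sum_(r < Lh.+1 ^ 2) sqmod (zh n r * slsht_coef h f r n - slsht_coef h g r n))%:E.
Proof.
move=> hf hg; rewrite -(sqnorm_sum _ (fun r => zh n r * slsht_coef h f r n - slsht_coef h g r n)).
congr sqnorm; apply/funext => y; rewrite slshtE // -sumrB; apply: eq_bigr => r _.
rewrite mulrBl; congr (_ * _ - _); rewrite mulrC /zeta_fun shcoef_sum //; congr (_ * _).
rewrite (_ : (fun y' => _) = fun y' => \sum_(i < Lh.+1 ^ 2) slsht_coef h f i n * Yn i y').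
  exact: (shcoef_sum (fun i => slsht_coef h f i n)).
by apply/funext => y'; rewrite slshtE.
Qed.

End Slsht.

(** * Random coefficients and the scalar quadratic risk *)

Section Processes.
Context (R : realType) d (T : measurableType d) (P : probability T R).
Local Notation C := R[i].
Local Notation leb := (@lebesgue_measure R).
Local Notation L2 := (@leb2 R).
Local Notation S2 := (@S2dom R).
Local Notation Re := (@complex.Re R).
Local Notation Im := (@complex.Im R).
Implicit Types s z : T -> R * R -> C.

(** Tonelli turns the planar integral into two integrals over the line, and measurability in the
    remaining variables is preserved by each of them. *)
Lemma measurable_integral_section (f : T * (measurableTypeR R * measurableTypeR R) -> \bar R) :
  measurable_fun setT f -> (forall x, 0 <= f x)%E ->
  measurable_fun setT (fun w => \int[L2]_x f (w, x))%E.
Proof.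
move=> mf f0.
have -> : (fun w => \int[L2]_x f (w, x))%E = (fun w => \int[leb]_a \int[leb]_b f (w, (a, b)))%E.
  apply/funext => w.
  have mfw : measurable_fun setT (fun x => f (w, x)).
    exact: (measurableT_comp mf (pair1_measurable w)).
  exact: (@fubini_tonelli1 _ _ _ _ R leb leb (fun x => f (w, x)) mfw (fun x => f0 (w, x))).
pose F1 (wab : (T * measurableTypeR R) * measurableTypeR R) := f (wab.1.1, (wab.1.2, wab.2)).
have mF1 : measurable_fun setT F1.
  apply: (measurableT_comp mf); apply: measurable_fun_pair.
    by apply: (measurableT_comp measurable_fst); exact: measurable_fst.
  apply: measurable_fun_pair; last exact: measurable_snd.
  by apply: (measurableT_comp measurable_snd); exact: measurable_fst.
have m1 := @measurable_fun_fubini_tonelli_F _ _ _ _ R leb F1 mF1 (fun x => f0 _).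
apply: (@measurable_fun_fubini_tonelli_F _ _ _ _ R leb _ m1) => x.
by apply: integral_ge0 => y _; exact: f0.
Qed.

Lemma measurable_Rintegral_section (g : T * (measurableTypeR R * measurableTypeR R) -> R) :
  measurable_fun setT g -> measurable_fun setT (fun w => \int[L2]_(x in S2) g (w, x)).
Proof.
move=> mg; pose G := EFin \o (fun wx => g wx * \1_S2 wx.2).
have mG : measurable_fun setT G.
  apply/measurable_EFinP; apply: measurable_funM => //.
  apply: (measurableT_comp (measurable_indic _)); last exact: measurable_snd.
  exact: measurable_S2dom.
have -> : (fun w => \int[L2]_(x in S2) g (w, x)) =
    fine \o (fun w => \int[L2]_x (G^\+ (w, x)) - \int[L2]_x (G^\- (w, x)))%E.
  apply/funext => w /=; rewrite Rintegral_mkcond /Rintegral integralE.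
  by congr (fine (_ - _)%E); apply: eq_integral => x _;
    rewrite ?funeposE ?funenegE /G /= patchE indicE; case: (x \in S2); rewrite ?mulr1 ?mulr0.
apply: measurableT_comp => //; apply: emeasurable_funB.
  by apply: (@measurable_integral_section G^\+%E) => //; exact: measurable_funepos.
by apply: (@measurable_integral_section G^\-%E) => //; exact: measurable_funeneg.
Qed.

Lemma measurable_process_section s w : measurable_process s -> cmeasurable S2 (s w).
Proof.
move=> [m1 m2]; split; apply: measurable_funTS.
  exact: (measurableT_comp m1 (pair1_measurable w)).
exact: (measurableT_comp m2 (pair1_measurable w)).
Qed.

Lemma cmeasurable_shcoef s c : measurable_process s -> cmeasurable setT (fun w => shcoef (s w) c).
Proof.
move=> ms; pose F (wx : T * (R * R)) := s wx.1 wx.2 * (Yn c wx.2)^* * (sin wx.2.1)%:C%C.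
have [m1 m2] : cmeasurable setT F.
  apply: cmeasurableM; last first.
    split; last exact: measurable_cst.
    apply: (measurableT_comp (continuous_measurable_fun (@continuous_sin R))).
    by apply: (measurableT_comp measurable_fst); exact: measurable_snd.
  apply: cmeasurableM; first exact: ms.
  have [m1 m2] := cmeasurableJ (@cmeasurable_Yn R c setT).
  split; first exact: (measurableT_comp m1 measurable_snd).
  exact: (measurableT_comp m2 measurable_snd).
rewrite /shcoef /sinner; split.
  by under eq_fun do rewrite cintE /=; exact: (measurable_Rintegral_section m1).
by under eq_fun do rewrite cintE /=; exact: (measurable_Rintegral_section m2).
Qed.

Lemma sl2_realization s w : measurable_process s -> (sqnorm (s w) < +oo)%E -> sl2 (s w).
Proof. by move=> ms; apply: sl2_of_sqnorm; exact: measurable_process_section. Qed.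

(** Pythagoras for the orthogonal variables [A] and [B]. *)
Lemma cdot_wsum (A B : T -> C) (u v : C) : cL2 P setT A -> cL2 P setT B -> cdot P setT A B = 0 ->
  cdot P setT (fun w => u * A w + v * B w) (fun w => u * A w + v * B w) =
  (sqmod u * Re (cdot P setT A A) + sqmod v * Re (cdot P setT B B))%:C%C.
Proof.
move=> hA hB AB; have mT := @measurableT _ T.
have huA := cL2Z mT u hA; have hvB := cL2Z mT v hB.
have hW := cL2D mT huA hvB; set W := (fun w => _) in hW *.
have BA : cdot P setT B A = 0 by rewrite (cdot_conj mT hA hB) AB conjC0.
have AW : cdot P setT A W = u^* * cdot P setT A A.
  rewrite (cdot_conj mT hW hA) (cdotDl mT) // !(cdotZl mT) // BA mulr0 addr0.
  by rewrite conjC_mul -(cdot_conj mT hA hA).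
have BW : cdot P setT B W = v^* * cdot P setT B B.
  rewrite (cdot_conj mT hW hB) (cdotDl mT) // !(cdotZl mT) // AB mulr0 add0r.
  by rewrite conjC_mul -(cdot_conj mT hB hB).
rewrite [LHS](cdotDl mT) // !(cdotZl mT) // AW BW !mulrA -!sqmodE.
by rewrite (cdot_self hA) (cdot_self hB) -!rcM -rcD.
Qed.

Lemma mse_summand (A B : T -> C) (x : C) : cL2 P setT A -> cL2 P setT B -> cdot P setT A B = 0 ->
  (\int[P]_w (sqmod (x * (A w + B w) - A w))%:E)%E =
  (sqmod (x - 1) * Re (cdot P setT A A) + sqmod x * Re (cdot P setT B B))%:E.
Proof.
move=> hA hB AB; have mT := @measurableT _ T.
have hW := cL2D mT (cL2Z mT (x - 1) hA) (cL2Z mT x hB).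
have e w : x * (A w + B w) - A w = (x - 1) * A w + x * B w by ring.
under eq_integral do rewrite e.
by rewrite (cdot_normE mT hW) cdot_wsum.
Qed.

End Processes.

(** * Series with finitely many nonzero terms *)

Section FiniteSeries.
Variable R : realType.
Local Notation C := R[i].
Local Notation Re := (@complex.Re R).
Local Notation Im := (@complex.Im R).

Lemma lim_fin_series (K : nat) (a : nat -> R) : (forall k, (K <= k)%N -> a k = 0) ->
  limn (fun N => \sum_(k < N) a k) = \sum_(k < K) a k.
Proof.
move=> a0; apply: cvg_lim => //; apply: cvg_near_cst.
near=> N; have KN : (K <= N)%N by near: N; exact: nbhs_infty_ge.
rewrite -!(big_mkord xpredT) (big_cat_nat (leq0n K) KN) //= [X in _ + X = _]big_nat [X in _ + X = _]big1 ?addr0 //.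
by move=> i /andP[Ki _]; exact: a0.
Unshelve. all: by end_near. Qed.

Lemma cseries_fin (K : nat) (a : nat -> C) : (forall k, (K <= k)%N -> a k = 0) ->
  cseries a = \sum_(k < K) a k.
Proof.
move=> a0; rewrite /cseries (@lim_fin_series K (fun k => Re (a k))); last by move=> k /a0 ->.
rewrite (@lim_fin_series K (fun k => Im (a k))); last by move=> k /a0 ->.
apply/eqP; rewrite eq_complex (big_morph Re (@cReD R) (erefl _)).
by rewrite (big_morph Im (@cImD R) (erefl _)) !eqxx.
Qed.

Lemma dseries_fin (K : nat) (a : nat -> nat -> C) :
  (forall c c', (K <= c)%N || (K <= c')%N -> a c c' = 0) ->
  dseries a = \sum_(c < K) \sum_(c' < K) a c c'.
Proof.
move=> a0; have inner c : cseries (a c) = \sum_(c' < K) a c c'.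
  by apply: cseries_fin => k Kk; rewrite a0 ?Kk ?orbT.
rewrite /dseries; under eq_fun do rewrite inner.
by apply: cseries_fin => c Kc; rewrite big1 // => c' _; rewrite a0 ?Kc.
Qed.

End FiniteSeries.

(** * Minimization of the risk of a single coefficient *)

Section QuadraticRisk.
Variable R : realType.
Local Notation C := R[i].

(** Completing the square: the excess over the minimum is an explicit multiple of a squared
    distance, which yields minimality and uniqueness together. *)
Lemma quad_risk_sub (a b : R) (x : C) : a + b != 0 ->
  sqmod (x - 1) * a + sqmod x * b =
  sqmod ((a / (a + b))%:C%C - 1) * a + sqmod (a / (a + b))%:C%C * b
  + (a + b) * sqmod (x - (a / (a + b))%:C%C).
Proof.
by move=> ab; case: x => u v; rewrite /sqmod /= !subr0; field.
Qed.

Definition wiener (a b : R) : C := if 0 < a + b then (a / (a + b))%:C%C else 0.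

Lemma wiener_le (a b : R) (x : C) : 0 <= a -> 0 <= b ->
  sqmod (wiener a b - 1) * a + sqmod (wiener a b) * b <= sqmod (x - 1) * a + sqmod x * b.
Proof.
move=> a0 b0; rewrite /wiener; case: ltP => [ab|ab].
  rewrite [leRHS]quad_risk_sub ?lt0r_neq0 // lerDl mulr_ge0 ?sqmod_ge0 ?ltW //.
have -> : a = 0 by lra.
have -> : b = 0 by lra.
by rewrite !mulr0.
Qed.

Lemma wiener_uniq (a b : R) (x : C) : 0 < a + b ->
  sqmod (x - 1) * a + sqmod x * b = sqmod (wiener a b - 1) * a + sqmod (wiener a b) * b ->
  x = wiener a b.
Proof.
move=> ab; rewrite /wiener ab quad_risk_sub ?lt0r_neq0 // => /eqP.
rewrite -subr_eq0 addrAC subrr add0r mulf_eq0 gt_eqF //= /sqmod paddr_eq0 ?sqr_ge0 //.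
rewrite !sqrf_eq0 => /andP[r0 i0]; apply/eqP; rewrite -subr_eq0 eq_complex.
by rewrite r0 i0.
Qed.

End QuadraticRisk.

(** * The mean-square error *)

Section Risk.
Context (R : realType) d (T : measurableType d) (P : probability T R).
Local Notation C := R[i].
Local Notation Re := (@complex.Re R).
Local Notation Im := (@complex.Im R).
Implicit Types (s z : T -> R * R -> C) (h : R * R -> C).

Definition second_order s := [/\ measurable_process s,
  forall w, (sqnorm (s w) < +oo)%E &
  forall c, (\int[P]_w (sqmod (shcoef (s w) c))%:E < +oo)%E].

Lemma second_order_sl2 s w : second_order s -> sl2 (s w).
Proof. by move=> [ms fs _]; exact: sl2_realization. Qed.

Lemma second_order_shcoef s c : second_order s -> cL2 P setT (fun w => shcoef (s w) c).
Proof. by move=> [ms _ vs]; split; [exact: cmeasurable_shcoef|exact: vs]. Qed.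

Lemma slsht_coefD h r n f g : sl2 f -> sl2 g ->
  slsht_coef h (fun x => f x + g x) r n = slsht_coef h f r n + slsht_coef h g r n.
Proof.
move=> hf hg; rewrite /slsht_coef -mulrDr; congr (_ * _).
by rewrite !cint_YfY sinnerDl //; exact: sl2_YY.
Qed.

Lemma cL2_slsht_coef h r n s : second_order s ->
  cL2 P setT (fun w => slsht_coef h (s w) r n).
Proof.
move=> hs; have [K [_ GE]] := slsht_coef_expand h r n.
rewrite (_ : (fun w => _) = (fun w => \sum_(c < K) Hcoef h c r n * shcoef (s w) c)); last first.
  by apply/funext => w; rewrite GE //; exact: second_order_sl2.
apply: (cL2_sum measurableT) => c; apply: (cL2Z measurableT).
exact: second_order_shcoef.
Qed.

(** [K] is chosen before the processes, so one truncation serves signal, noise and cross term.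
    Sesquilinearity produces the conjugate of the second [H], which reality of [H] removes, as the
    stated formula requires. *)
Lemma cdot_slsht_coef h r n : (forall x, Im (h x) = 0) -> exists K,
  (forall c, (K <= c)%N -> Hcoef h c r n = 0) /\
  forall s z, second_order s -> second_order z ->
  cdot P setT (fun w => slsht_coef h (s w) r n) (fun w => slsht_coef h (z w) r n) =
  \sum_(c < K) \sum_(c' < K) Hcoef h c r n * Hcoef h c' r n * spec_cov P s z c c'.
Proof.
move=> hR; have [K [H0 GE]] := slsht_coef_expand h r n.
exists K; split=> // s z hs hz.
have es : (fun w => slsht_coef h (s w) r n) = (fun w => \sum_(c < K) Hcoef h c r n * shcoef (s w) c).
  by apply/funext => w; rewrite GE //; exact: second_order_sl2.
have ez : (fun w => slsht_coef h (z w) r n) = (fun w => \sum_(c < K) Hcoef h c r n * shcoef (z w) c).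
  by apply/funext => w; rewrite GE //; exact: second_order_sl2.
have hG := cL2_slsht_coef h r n hz.
rewrite es (cdot_suml measurableT _ (fun c : 'I_K => Hcoef h c r n)
  (F := fun (c : 'I_K) w => shcoef (s w) c)) //; last by move=> c; exact: second_order_shcoef.
apply: eq_bigr => c _; rewrite ez (cdot_sumr measurableT _ (fun c : 'I_K => Hcoef h c r n)
  (F := fun (c : 'I_K) w => shcoef (z w) c)); try by move=> *; exact: second_order_shcoef.
rewrite mulr_sumr; apply: eq_bigr => c' _.
by rewrite Hcoef_real // mulrA.
Qed.

Definition slsht_var h s r n : R := Re (cdot P setT
  (fun w => slsht_coef h (s w) r n) (fun w => slsht_coef h (s w) r n)).

Lemma slsht_var_ge0 h s r n : 0 <= slsht_var h s r n.
Proof. exact: cdot_ge0. Qed.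

Lemma slsht_varE h s r n : second_order s -> (slsht_var h s r n)%:C%C =
  cdot P setT (fun w => slsht_coef h (s w) r n) (fun w => slsht_coef h (s w) r n).
Proof. by move=> hs; rewrite (cdot_self (cL2_slsht_coef h r n hs)). Qed.

Section Uncorrelated.
Context (h : R * R -> C) (s z : T -> R * R -> C).
Hypotheses (hR : forall x, Im (h x) = 0) (hs : second_order s) (hz : second_order z).
Local Notation den n r := (dseries (fun c c' => Hcoef h c r n * Hcoef h c' r n
                               * (spec_cov P s s c c' + spec_cov P z z c c'))).

(** The denominator is thus a real number seen as complex, so the test [0 < den] in [zeta_opt], made
    in the partial order of the complex numbers, is a comparison of reals. *)
Lemma den_slsht_var n r : den n r = (slsht_var h s r n + slsht_var h z r n)%:C%C.
Proof.
have [K [H0 cE]] := cdot_slsht_coef r n hR.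
rewrite (@dseries_fin _ K); last first.
  by move=> c c' /orP[/H0|/H0] ->; rewrite ?mulr0 !mul0r.
pose S u := \sum_(c < K) \sum_(c' < K) Hcoef h c r n * Hcoef h c' r n * spec_cov P u u c c'.
have SE u : second_order u -> S u = (slsht_var h u r n)%:C%C.
  by move=> hu; rewrite slsht_varE //; exact/esym/cE.
transitivity (S s + S z); last by rewrite rcD; congr (_ + _); exact: SE.
rewrite /S -big_split; apply: eq_bigr => c _.
by rewrite -big_split; apply: eq_bigr => c' _; rewrite mulrDr.
Qed.

Lemma zeta_opt_wiener n r :
  zeta_opt P h s z n r = wiener (slsht_var h s r n) (slsht_var h z r n).
Proof.
rewrite /zeta_opt den_slsht_var /wiener ltcR; case: ifP => // _.
have [K [H0 cE]] := cdot_slsht_coef r n hR.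
rewrite (@dseries_fin _ K); last first.
  by move=> c c' /orP[/H0|/H0] ->; rewrite ?mulr0 !mul0r.
by rewrite -(cE _ _ hs hs) -(slsht_varE h r n hs) -fmorph_div.
Qed.

Hypothesis hsz : forall c c', spec_cov P s z c c' = 0.

Definition risk (zh : nat -> nat -> C) n r : R :=
  sqmod (zh n r - 1) * slsht_var h s r n + sqmod (zh n r) * slsht_var h z r n.

Lemma risk_ge0 zh n r : 0 <= risk zh n r.
Proof. by rewrite addr_ge0 // mulr_ge0 ?sqmod_ge0 ?slsht_var_ge0. Qed.

Lemma EssE Lh zh :
  Ess P Lh h s z zh = (\sum_(n <oo) (\sum_(r < Lh.+1 ^ 2) risk zh n r)%:E)%E.
Proof.
(* Uncorrelatedness of the harmonic coefficients passes to [slsht_coef] because those are finite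
   combinations of them. *)
have AB r n : cdot P setT (fun w => slsht_coef h (s w) r n) (fun w => slsht_coef h (z w) r n) = 0.
  have [K [_ ->]] := cdot_slsht_coef r n hR => //.
  by rewrite big1 // => c _; rewrite big1 // => c' _; rewrite hsz mulr0.
pose E n r w := zh n r * (slsht_coef h (s w) r n + slsht_coef h (z w) r n) - slsht_coef h (s w) r n.
have mE n r : measurable_fun setT (fun w => (sqmod (E n r w))%:E).
  apply/measurable_EFinP; apply: measurable_sqmod.
  have [ms _] := cL2_slsht_coef h r n hs; have [mz _] := cL2_slsht_coef h r n hz.
  rewrite /E; under eq_fun do rewrite -mulN1r.
  exact: (cmeasurableD (cmeasurableM (cmeasurable_cst _ _) (cmeasurableD ms mz))
    (cmeasurableM (cmeasurable_cst _ _) ms)).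
transitivity (\int[P]_w \sum_(n <oo) (\sum_(r < Lh.+1 ^ 2) (sqmod (E n r w))%:E))%E.
  apply: eq_integral => w _; apply: eq_eseriesr => n _.
  have sw := second_order_sl2 w hs; have zw := second_order_sl2 w hz.
  rewrite ess_summandE ?sumEFin //; last exact: sl2D.
  by congr EFin; apply: eq_bigr => r _; rewrite slsht_coefD.
rewrite integral_nneseries //; last 2 first.
- by move=> n; exact: emeasurable_sum.
- by move=> n w _; apply: sume_ge0 => r _; rewrite lee_fin sqmod_ge0.
apply: eq_eseriesr => n _.
rewrite ge0_integral_sum //; last by move=> r w _; rewrite lee_fin sqmod_ge0.
rewrite -sumEFin; apply: eq_bigr => r _.
exact: (mse_summand (zh n r) (cL2_slsht_coef h r n hs) (cL2_slsht_coef h r n hz) (AB r n)).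
Qed.

End Uncorrelated.
End Risk.

(** * Equality of dominated sums, and the minimizer *)

Lemma nneseries_dominated_eq (R : realType) (u v : nat -> R) (n : nat) :
  (forall k, 0 <= v k) -> (forall k, v k <= u k) ->
  (\sum_(k <oo) (u k)%:E = \sum_(k <oo) (v k)%:E)%E -> (\sum_(k <oo) (v k)%:E < +oo)%E ->
  u n = v n.
Proof.
move=> v0 vu uv vfin.
have v0' k : (0 <= (v k)%:E)%E by rewrite lee_fin.
have u0' k : (0 <= (u k)%:E)%E by rewrite lee_fin (le_trans (v0 k)).
apply/eqP; rewrite eq_le vu andbT -lee_fin.
move: uv vfin; rewrite !(@nneseriesD1 _ _ n xpredT) //.
set A := (\sum_(_ <= k <oo | _) (u k)%:E)%E; set B := (\sum_(_ <= k <oo | _) (v k)%:E)%E.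
have BA : (B <= A)%E by apply: lee_nneseries => [k _ _|k _]; rewrite ?lee_fin.
have B0 : (0 <= B)%E by apply: nneseries_ge0.
move=> e fin.
(* Finite tails can be cancelled, leaving a comparison of the single terms of index [n]; two
   infinite totals would say nothing about them. *)
have Bfin : B \is a fin_num by rewrite ge0_fin_numE // (le_lt_trans _ fin) // leeDr.
have Afin : A \is a fin_num.
  by rewrite ge0_fin_numE ?(le_trans B0) // (le_lt_trans _ fin) // -e leeDr.
move: BA e; rewrite -(fineK Afin) -(fineK Bfin) !lee_fin => BA [e]; lra.
Qed.

(** The differences are nonnegative and sum to zero, so each of them is zero. *)
Lemma sum_dominated_eq (R : realDomainType) (I : finType) (u v : I -> R) (i : I) :
  (forall j, v j <= u j) -> \sum_j u j = \sum_j v j -> u i = v i.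
Proof.
move=> vu /eqP; rewrite -subr_eq0 -sumrB psumr_eq0 => [/allP/(_ i (mem_index_enum _))|j _].
  by rewrite subr_eq0 => /eqP.
by rewrite subr_ge0.
Qed.

Theorem theorem1 (R : realType) (d : measure_display) (T : measurableType d)
    (P : probability T R) (s z : T -> R * R -> R[i])
    (Lh : nat) (h : R * R -> R[i]) :
  (* s and z: zero-mean Gaussian random processes on S^2 ... *)
  measurable_process s -> measurable_process z ->
  centered_gaussian_process P s -> centered_gaussian_process P z ->
  (* ... whose realizations lie in L^2(S^2) ... *)
  (forall w, (sqnorm (s w) < +oo)%E) -> (forall w, (sqnorm (z w) < +oo)%E) ->
  (* ... with finite spectral second moments (so C_S, C_Z exist) ... *)
  (forall c, (\int[P]_w ((complex.Re (shcoef (s w) c)) ^+ 2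
                         + (complex.Im (shcoef (s w) c)) ^+ 2)%:E < +oo)%E) ->
  (forall c, (\int[P]_w ((complex.Re (shcoef (z w) c)) ^+ 2
                         + (complex.Im (shcoef (z w) c)) ^+ 2)%:E < +oo)%E) ->
  (* ... and uncorrelated: E{ s^_c conj(z^_c') } = 0 *)
  (forall c c', spec_cov P s z c c' = 0) ->
  (* h: real-valued window, measurable, azimuthally symmetric,
     band-limited with maximum degree Lh, unit norm *)
  (forall x, complex.Im (h x) = 0) ->
  measurable_fun (@S2dom R) (fun x => complex.Re (h x)) ->
  (forall th ph ph', h (th, ph) = h (th, ph')) ->
  (forall n, (Lh < sh_deg n)%N -> shcoef h n = 0) ->
  sinner h h = 1 ->
  (* zeta_opt minimizes E_ss ... *)
  (forall zh : nat -> nat -> R[i],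
      (Ess P Lh h s z (zeta_opt P h s z) <= Ess P Lh h s z zh)%E) /\
  (* ... and (when E_ss is finite) every minimizer agrees with it wherever
     the denominator is > 0 *)
  (forall zh : nat -> nat -> R[i],
      Ess P Lh h s z zh = Ess P Lh h s z (zeta_opt P h s z) ->
      (Ess P Lh h s z (zeta_opt P h s z) < +oo)%E ->
      forall n r, (r < Lh.+1 ^ 2)%N ->
      0 < dseries (fun c c' => Hcoef h c r n * Hcoef h c' r n
                               * (spec_cov P s s c c' + spec_cov P z z c c')) ->
      zh n r = zeta_opt P h s z n r).
Proof.
move=> ms mz _ _ fs fz vs vz hsz hR _ _ _ _.
have hs : second_order P s := And3 ms fs vs.
have hz : second_order P z := And3 mz fz vz.
have risk_opt zh n r : risk P h s z (zeta_opt P h s z) n r <= risk P h s z zh n r.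
  by rewrite /risk zeta_opt_wiener // wiener_le // slsht_var_ge0.
pose tot zh n : R := \sum_(r < Lh.+1 ^ 2) risk P h s z zh n r.
have tot_ge0 zh n : 0 <= tot zh n by apply: sumr_ge0 => r _; exact: risk_ge0.
have tot_opt zh n : tot (zeta_opt P h s z) n <= tot zh n by exact: ler_sum.
split=> [zh|zh]; rewrite !EssE //.
  by apply: lee_nneseries => [n _ _|n _]; [exact: (tot_ge0 _ n)|exact: (tot_opt _ n)].
move=> eqE finE n r rN; rewrite den_slsht_var // ltcR => den_gt0.
(* Each summand for [zeta_opt] is already the smallest possible, so equal finite totals force
   equality for every [n], and then for every [r]. *)
have totE : tot zh n = tot (zeta_opt P h s z) n.
  exact: (@nneseries_dominated_eq _ (tot zh) (tot (zeta_opt P h s z))).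
have := @sum_dominated_eq _ _ _ _ (Ordinal rN) (fun r => risk_opt zh n r) totE.
by rewrite /risk zeta_opt_wiener // => /(wiener_uniq den_gt0).
Qed.
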